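(* Let $\mathbf{k}$ be an arbitrary field, let $U$ be a $2$-dimensional $\mathbf{k}$-vector space, and let $i\geq 1$. For each $d\geq 0$, the vector space isomorphism $$\psi_d^i:\operatorname{Sym}^d(\mathrm{D}^iU)\longrightarrow\textstyle\bigwedge^i(\operatorname{Sym}^{d+i-1}U)$$ defined by $\psi_d^i=\sigma_d^i\circ\epsilon_d^i$ is $\mathfrak{sl}_2$-equivariant.
   Context: Choose a basis $(x_1,x_2)$ of $U$, dehomogenized as $x_1=x$, $x_2=1$, so $\operatorname{Sym}^dU$ has basis $1,x,\ldots,x^d$. $\mathrm{D}^dU$ is the space of symmetric tensors in $U^{\otimes d}$, with basis $x^{(0)},\ldots,x^{(d)}$, $x^{(i)}$ being the sum of all distinct permutations of $x_1^{\otimes i}\otimes x_2^{\otimes(d-i)}$. $\mathfrak{sl}_2=\mathfrak{sl}(U)$ is the Lie algebra of trace-zero endomorphisms of $U$; its lowering and raising operators act by $\mathfrak{L}x^i=i\,x^{i-1}$, $\mathfrak{R}x^i=(d-i)x^{i+1}$ on $\operatorname{Sym}^dU$ and $\mathfrak{L}x^{(i)}=(d-i+1)x^{(i-1)}$, $\mathfrak{R}x^{(i)}=(i+1)x^{(i+1)}$ on $\mathrm{D}^dU$, and the action extends to symmetric and exterior powers in the usual way (by derivations). $\Lambda_i\subseteq\mathbf{k}[z_1,\ldots,z_i]$ is the ring of symmetric polynomials. $\mathcal{P}_i(d)$ is the set of partitions $\lambda=(\lambda_1\geq\cdots\geq\lambda_i\geq 0)$ with $\lambda_1\leq d$, and $\mathcal{P}'_i(d)$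 is the set of partitions $\mu=(\mu_1\geq\cdots\geq\mu_d\geq 0)$ with at most $d$ parts, all of size at most $i$. For $\lambda\in\mathcal{P}_i(d)$, $s_\lambda=\det(z_k^{\lambda_\ell+i-\ell})_{1\le k,\ell\le i}/\det(z_k^{i-\ell})_{1\le k,\ell\le i}$ is the Schur polynomial; for $\mu\in\mathcal{P}'_i(d)$, $e_\mu=e_{\mu_1}e_{\mu_2}\cdots e_{\mu_d}$, where $e_0=1,e_1,\ldots,e_i$ are the elementary symmetric polynomials in $z_1,\ldots,z_i$. The families $\{s_\lambda:\lambda\in\mathcal{P}_i(d)\}$ and $\{e_\mu:\mu\in\mathcal{P}'_i(d)\}$ are bases of the same subspace $\Lambda_i(d)\subseteq\Lambda_i$. The linear isomorphism $\epsilon_d^i:\operatorname{Sym}^d(\mathrm{D}^iU)\to\Lambda_i(d)$ sends the monomial $x^{(\mu_1)}\cdot x^{(\mu_2)}\cdots x^{(\mu_d)}$ to $e_\mu$ for $\mu\in\mathcal{P}'_i(d)$. The linear isomorphism $\sigma_d^i:\Lambda_i(d)\to\bigwedge^i(\operatorname{Sym}^{d+i-1}U)$ sends $s_\lambda$ to $x^{\lambda_1+i-1}\wedge x^{\lambda_2+i-2}\wedge\cdots\wedge x^{\lambda_i}$ for $\lambda\in\mathcal{P}_i(d)$. *)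

(* Defs.v *)
From HB Require Import structures.
From mathcomp Require Import all_boot all_order all_fingroup all_algebra.
From mathcomp Require Import mpoly zify.

Set Implicit Arguments.
Unset Strict Implicit.
Unset Printing Implicit Defensive.

Import GRing.Theory.

Local Open Scope ring_scope.

(** * Linear algebra *)

Definition lftrace (k : fieldType) (V : vectType k) (g : 'End(V)) : k :=
  \tr (passmx.mxof (vbasis {:V}) (vbasis {:V}) g).

(* The linear map sending the basis vectors [b j] to [w j]. *)
Definition lext (k : fieldType) (V W : vectType k) (I : finType)
    (b : I -> V) (w : I -> W) : 'Hom(V, W) :=
  linfun (fun v => \sum_(j : I) coord (codom_tuple b) (enum_rank j) v *: w j).

Lemma lextE (k : fieldType) (V W : vectType k) (I : finType)
    (b : I -> V) (w : I -> W) (j : I) :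
  free (codom b) -> lext b w (b j) = w j.
Proof.
move=> fb; pose F v := \sum_(j : I) coord (codom_tuple b) (enum_rank j) v *: w j.
have Flin : linear F.
  move=> c u v; rewrite /F scaler_sumr -big_split /=; apply: eq_bigr => l _.
  by rewrite linearP /= scalerDl scalerA.
pose FL : {linear V -> W} := HB.pack F (GRing.isLinear.Build _ _ _ _ F Flin).
rewrite (lfunE FL) /= /F.
have bE l : coord (codom_tuple b) l (b j) = (enum_rank j == l)%:R.
  have <- : (codom_tuple b)`_(enum_rank j) = b j.
    by rewrite /= (nth_codom _ _ (enum_rank j)) enum_rankK.
  by rewrite coord_free.
rewrite (bigD1 j) //= bE eqxx scale1r big1 ?addr0 // => l lj.
by rewrite bE (inj_eq enum_rank_inj) eq_sym (negbTE lj) scale0r.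
Qed.

(* The quotient [T / W], carried by a complement of [W]. *)
Section Quotient.
Variables (k : fieldType) (T : vectType k) (W : {vspace T}).

Definition quot : vectType k := subvs_of W^C%VS.

Definition qproj (t : T) : quot := vsproj W^C%VS (daddv_pi W^C%VS W t).

Lemma compl_capv : (W^C :&: W)%VS = 0%VS.
Proof. by rewrite capvC capv_compl. Qed.

Lemma qproj_linear : linear qproj.
Proof. by move=> c u v; rewrite /qproj !linearP. Qed.

Lemma qproj_sum (I : finType) (F : I -> T) :
  qproj (\sum_j F j) = \sum_j qproj (F j).
Proof. by rewrite /qproj !linear_sum. Qed.

Lemma qproj_eq0 t : (qproj t == 0) = (t \in W).
Proof.
have tE := daddv_pi_add compl_capv (w := t).
have {}tE : daddv_pi W^C W t + daddv_pi W W^C t = t.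
  by apply: tE; rewrite addvC addv_complf memvf.
apply/eqP/idP => [/(congr1 val) /= | tW].
  rewrite vsprojK ?memv_pi // => t0; rewrite -tE.
  by rewrite /= in t0 *; rewrite t0 add0r memv_pi.
move/eqP: tE; rewrite (daddv_pi_id _ tW) ?capv_compl //.
rewrite -[X in _ == X]add0r (inj_eq (addIr t)) => /eqP t0.
by apply: val_inj; rewrite /= vsprojK ?memv_pi.
Qed.

Lemma qprojK (q : quot) : qproj (vsval q) = q.
Proof.
by rewrite /qproj daddv_pi_id ?compl_capv ?subvsP ?vsvalK.
Qed.

(* The map induced on [T / W] by an endomorphism of [T] preserving [W]. *)
Definition qmap (f : T -> T) (q : quot) : quot := qproj (f (vsval q)).

Lemma qmap_proj (f : {linear T -> T}) t :
  (forall u, u \in W -> f u \in W) -> qmap f (qproj t) = qproj (f t).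
Proof.
pose Q : {linear T -> quot} :=
  HB.pack qproj (GRing.isLinear.Build k T quot _ qproj qproj_linear).
move=> fW; apply/eqP; rewrite /qmap -subr_eq0 -[qproj]/(Q : T -> quot) -linearB.
rewrite [_ == 0]qproj_eq0 -linearB fW // -qproj_eq0 -[qproj]/(Q : T -> quot).
by rewrite linearB /= qprojK subrr.
Qed.

End Quotient.

(** * Tensor, divided, symmetric and exterior powers *)

Section Powers.
Variables (k : fieldType) (V : vectType k) (d : nat).

Local Notation word := {ffun 'I_d -> 'I_(\dim {:V})}.

(* Tensors are given by their coordinates on the pure tensors of [vbasis]. *)
Definition tpow : vectType k := {ffun word -> k^o}.

Definition tcoef (t : tpow) (f : word) : k := (t : {ffun word -> k^o}) f.

Definition pure (v : 'I_d -> V) : tpow :=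
  [ffun f : word => \prod_(a < d) coord (vbasis {:V}) (f a) (v a)].

Lemma eq_pure v w : v =1 w -> pure v = pure w.
Proof.
by move=> vw; apply/ffunP => f; rewrite !ffunE; apply: eq_bigr => a _; rewrite vw.
Qed.

Definition wtens (f : word) : 'I_d -> V := fun a => (vbasis {:V})`_(f a).

Definition upd (v : 'I_d -> V) (a : 'I_d) (u : V) : 'I_d -> V :=
  fun b => if b == a then u else v b.

Lemma pureD v a x y : pure (upd v a (x + y)) = pure (upd v a x) + pure (upd v a y).
Proof.
apply/ffunP => f; rewrite !ffunE !(bigD1 (P := xpredT) a) //= /upd eqxx linearD.
rewrite mulrDl; congr (_ * _ + _ * _); apply: eq_bigr => b /negbTE -> //.
Qed.

Lemma tpow_sum (t : tpow) : t = \sum_(f : word) tcoef t f *: pure (wtens f).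
Proof.
apply/ffunP => h; rewrite sum_ffunE (bigD1 h) //= big1 ?addr0 => [|f fh].
  rewrite !ffunE big1 ?mulr1 /GRing.scale /= ?mulr1 // => a _.
  by rewrite coord_free ?eqxx // (basis_free (vbasisP _)).
rewrite !ffunE; have [a fa] : exists a, f a != h a.
  apply/existsP; rewrite -negb_forall; apply: contra fh => /forallP fh.
  by apply/eqP/ffunP => a; apply/eqP.
rewrite (bigD1 a) //= coord_free ?(basis_free (vbasisP _)) //.
by rewrite (negbTE fa) mul0r scaler0.
Qed.

(* The action of an endomorphism [g] of [V] by derivations. *)
Definition tder (g : V -> V) (t : tpow) : tpow :=
  \sum_(f : word) tcoef t f *:
    \sum_(a < d) pure (upd (wtens f) a (g (wtens f a))).

Lemma tder_pure (g : {linear V -> V}) (v : 'I_d -> V) :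
  tder g (pure v) = \sum_(a < d) pure (upd v a (g (v a))).
Proof.
apply/ffunP => h; rewrite /tder !sum_ffunE.
under eq_bigr => f _ do rewrite ffunE sum_ffunE /tcoef ffunE scaler_sumr.
rewrite exchange_big /=; apply: eq_bigr => a _.
under eq_bigr => f _ do rewrite ffunE /GRing.scale /= -big_split /=.
pose F (b : 'I_d) j := coord (vbasis {:V}) j (v b) *
  coord (vbasis {:V}) (h b) (if b == a then g (vbasis {:V})`_j
                             else (vbasis {:V})`_j).
transitivity (\sum_(f : word) \prod_(b < d) F b (f b)).
  apply: eq_bigr => f _; apply: eq_bigr => b _; rewrite /F /upd /wtens.
  by case: eqP => [->|].
rewrite -(bigA_distr_bigA F) ffunE; apply: eq_bigr => b _; rewrite /F /upd.
have vE := coord_vbasis (memvf (v b)).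
case: eqP => [<- |_].
  by rewrite [in RHS]vE !linear_sum; apply: eq_bigr => j _; rewrite !linearZ.
by rewrite [in RHS]vE !linear_sum; apply: eq_bigr => j _; rewrite !linearZ.
Qed.

Definition tact (s : 'S_d) (t : tpow) : tpow :=
  [ffun f : word => tcoef t [ffun a => f (s a)]].

Lemma tcoef_linear f : linear (tcoef^~ f : tpow -> k^o).
Proof.
by move=> c u v; rewrite /tcoef [LHS]ffunE ffunE.
Qed.

Lemma tact_linear s : linear (tact s).
Proof.
by move=> c u v; apply/ffunP => f; rewrite !ffunE tcoef_linear.
Qed.

HB.instance Definition _ s :=
  GRing.isLinear.Build k tpow tpow _ (tact s) (tact_linear s).

Lemma tact_pure s v : tact s (pure v) = pure (fun a => v ((s^-1)%g a)).
Proof.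
apply/ffunP => f; rewrite /tact /tcoef !ffunE.
rewrite (reindex_inj (@perm_inj _ (s^-1)%g)) /=; apply: eq_bigr => a _.
by rewrite ffunE permKV.
Qed.

Definition symtens : {vspace tpow} :=
  (\bigcap_(s : 'S_d) fixedSpace (linfun (tact s)))%VS.

Lemma symtensP t : reflect (forall s, tact s t = t) (t \in symtens).
Proof.
apply: (iffP idP) => [/(subvP (bigcapv_inf _ _ (subvv _))) tS s | tS].
  by have /fixedSpaceP := tS s isT; rewrite lfunE.
rewrite memvE; apply/subv_bigcapP => s _; rewrite -memvE.
by apply/fixedSpaceP; rewrite lfunE /= tS.
Qed.

Definition divpow : vectType k := subvs_of symtens.

(* [tder g] preserves [symtens], see [divderE]. *)
Definition divder (g : V -> V) (t : divpow) : divpow :=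
  vsproj symtens (tder g (vsval t)).

(* Symmetric powers are the coinvariants of the symmetric group. *)
Definition symrel : {vspace tpow} :=
  (\sum_(s : 'S_d) limg (linfun (tact s) - \1%VF))%VS.

Definition sympow : vectType k := quot symrel.

Definition symprod (v : 'I_d -> V) : sympow := qproj symrel (pure v).

(* See [symder_prod]. *)
Definition symder (g : V -> V) : sympow -> sympow := qmap (tder g).

(* The span of the pure tensors with two equal entries; see [altrelP]. *)
Definition altrel : {vspace tpow} :=
  (\sum_(p : 'I_d * 'I_d | p.1 != p.2)
     fixedSpace (linfun (tact (tperm p.1 p.2))))%VS.

Lemma altrelP (W : {vspace tpow}) :
  (altrel <= W)%VS <->
  (forall v a b, a != b -> v a = v b -> pure v \in W).
Proof.
split=> [/subvP sW v a b ab vab | sW].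
  apply: sW; apply: (subvP (sumv_sup (a, b) ab (subvv _))).
  apply/fixedSpaceP; rewrite lfunE /= tact_pure; apply: eq_pure => c.
  by rewrite tpermV; case: tpermP => [->|->|].
apply/subv_sumP => -[a b] /= ab; apply/subvP => t /fixedSpaceP.
rewrite lfunE /= => tab.
pose s (f : word) : word := [ffun c => f (tperm a b c)].
have sK : involutive s by move=> f; apply/ffunP=> c; rewrite !ffunE tpermK.
have tE f : tcoef t (s f) = tcoef t f by rewrite -{2}tab /tcoef ffunE.
have sa f : s f a = f b by rewrite ffunE tpermL.
have sb f : s f b = f a by rewrite ffunE tpermR.
rewrite [t]tpow_sum (bigID (fun f : word => f a == f b)) /=.
apply: rpredD; first apply: rpred_sum => f /eqP fab.
  by apply/rpredZ/(sW _ a b) => //; rewrite /wtens fab.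
rewrite (bigID (fun f : word => f a < f b)%N) /=.
rewrite [X in _ + X](reindex_inj (inv_inj sK)) /=.
rewrite [X in _ + X](eq_bigl (fun f : word => (f a != f b) && (f a < f b)%N)); last first.
  move=> f; rewrite sa sb -leqNgt eq_sym; case: eqP => //= /eqP fab.
  by rewrite leq_eqVlt (negbTE (fab : (f a : nat) != f b)).
rewrite -big_split /=; apply: rpred_sum => f _; rewrite tE -scalerDr.
apply: rpredZ; pose v := wtens f; pose P x y := pure (upd (upd v a x) b y).
have PD x y z : P (x + y) z = P x z + P y z.
  have PE c w : P c w = pure (upd (upd v b w) a c).
    apply: eq_pure => e; rewrite /upd; case: (e =P b) => [->|//].
    by rewrite eq_sym (negbTE ab).
  by rewrite !PE pureD.
have PD' x y z : P x (y + z) = P x y + P x z by rewrite /P pureD.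
have PW x : P x x \in W.
  by apply: (sW _ a b ab); rewrite /upd !eqxx if_same.
have <- : P (v a) (v b) = pure v.
  by apply: eq_pure => c; rewrite /upd; case: eqP => [->|_] //; case: eqP => [->|].
have <- : P (v b) (v a) = pure (wtens (s f)).
  apply: eq_pure => c; rewrite /upd /v /wtens ffunE; case: tpermP => [->|->|].
  - by rewrite (negbTE ab) eqxx.
  - by rewrite eqxx.
  by move=> /eqP/negbTE-> /eqP/negbTE->.
have := PW (v a + v b); rewrite PD !PD' => PWW.
have := rpredB PWW (rpredD (PW (v a)) (PW (v b))).
by rewrite [P (v b) _ + _]addrC addrACA [X in X - _]addrC addrK.
Qed.

Definition extpow : vectType k := quot altrel.

Definition wedge (v : 'I_d -> V) : extpow := qproj altrel (pure v).

(* See [extder_wedge]. *)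
Definition extder (g : V -> V) : extpow -> extpow := qmap (tder g).

Section Stability.
Variable g : {linear V -> V}.

Lemma tder_linear : linear (tder g).
Proof.
move=> c t u; rewrite /tder scaler_sumr -big_split; apply: eq_bigr => f _ /=.
by rewrite tcoef_linear scalerDl scalerA.
Qed.

HB.instance Definition _ :=
  GRing.isLinear.Build k tpow tpow _ (tder g) tder_linear.

Lemma tder_act s t : tder g (tact s t) = tact s (tder g t).
Proof.
rewrite [t]tpow_sum !linear_sum; apply: eq_bigr => f _.
rewrite linearZ [LHS]linearZ linearZ /=; rewrite -tpow_sum.
congr (_ *: _); rewrite tact_pure tder_pure linear_sum.
rewrite [LHS](reindex_inj (@perm_inj _ s)); apply: eq_bigr => a _ /=.
rewrite tact_pure permK; apply: eq_pure => b; rewrite /upd.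
by rewrite -(inj_eq (@perm_inj _ s^-1%g)) permK.
Qed.

Lemma tder_symtens t : t \in symtens -> tder g t \in symtens.
Proof. by move/symtensP => tS; apply/symtensP => s; rewrite -tder_act tS. Qed.

Lemma tder_symrel t : t \in symrel -> tder g t \in symrel.
Proof.
move=> /memv_sumP[u uin ->]; rewrite linear_sum rpred_sum // => s _.
have /memv_imgP[t' _ ->] := uin s isT.
apply: (subvP (sumv_sup s isT (subvv _))); apply/memv_imgP.
exists (tder g t'); first exact: memvf.
by rewrite !add_lfunE !opp_lfunE !id_lfunE !lfunE linearB /= tder_act.
Qed.

Lemma tder_altrel t : t \in altrel -> tder g t \in altrel.
Proof.
pose G : 'End(tpow) := linfun (tder g).
suff /subvP H : (altrel <= G @^-1: altrel)%VS.
  by move/H; rewrite -memv_preim lfunE.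
apply/altrelP => v a b ab vab; rewrite -memv_preim lfunE /= tder_pure.
have altP := (altrelP altrel).1 (subvv _).
rewrite (bigD1 a) //= (bigD1 b) 1?eq_sym //= addrA rpredD //; last first.
  apply: rpred_sum => c /andP[ca cb]; apply: (altP _ a b) => //.
  by rewrite /upd ![_ == c]eq_sym (negbTE ca) (negbTE cb).
apply: (subvP (sumv_sup (a, b) ab (subvv _))); apply/fixedSpaceP.
rewrite lfunE linearD /= !tact_pure addrC; congr (_ + _); apply: eq_pure => c.
  rewrite tpermV /upd; case: tpermP => [->|->|]; rewrite ?eqxx ?vab //.
    by rewrite (negbTE ab) eq_sym (negbTE ab).
  by move=> /eqP/negbTE -> /eqP/negbTE ->.
rewrite tpermV /upd; case: tpermP => [->|->|]; rewrite ?eqxx ?vab //.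
  by rewrite (negbTE ab) eq_sym (negbTE ab).
by move=> /eqP/negbTE -> /eqP/negbTE ->.
Qed.

Lemma divderE t : vsval (divder g t) = tder g (vsval t).
Proof. by rewrite vsprojK // tder_symtens // subvsP. Qed.

Lemma symder_prod v :
  symder g (symprod v) = \sum_(a < d) symprod (upd v a (g (v a))).
Proof.
rewrite /symder /symprod qmap_proj; last exact: tder_symrel.
by rewrite /= tder_pure qproj_sum.
Qed.

Lemma extder_wedge v :
  extder g (wedge v) = \sum_(a < d) wedge (upd v a (g (v a))).
Proof.
rewrite /extder /wedge qmap_proj; last exact: tder_altrel.
by rewrite /= tder_pure qproj_sum.
Qed.

End Stability.

End Powers.

(** * Symmetric polynomials *)

(* Partitions with at most [m] parts, all of size at most [n]. *)
Definition part (m n : nat) :=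
  {t : m.-tuple 'I_n.+1 | sorted geq [seq nat_of_ord j | j <- t]}.

Definition parts (m n : nat) (t : part m n) (l : 'I_m) : nat := tnth (val t) l.

Section Schur.
Variables (k : fieldType) (i : nat).

Definition alternant (h : 'I_i -> nat) : {mpoly k[i]} :=
  \det (\matrix_(a < i, l < i) 'X_a ^+ h l).

(* Columns are indexed from [0], so that [delta l] is the textbook exponent
   [i - l] of the column [l + 1]. *)
Definition delta (l : 'I_i) : nat := i - l.+1.

Lemma alternantE h : alternant h =
  \sum_(s : 'S_i) (-1) ^+ s *: 'X_[k, [multinom h (s a) | a < i]].
Proof.
apply: eq_bigr => s _; rewrite -mul_mpolyC rmorphXn rmorphN1.
congr (_ * _); rewrite mpolyXE_id; apply: eq_bigr => a _.
by rewrite mxE mnmE.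
Qed.

Definition sdecr (h : 'I_i -> nat) := {homo h : l m / (l < m)%N >-> (m < l)%N}.

Lemma sdecr_sorted h : sdecr h -> sorted gtn (codom h).
Proof.
move=> hd; rewrite /codom /image_mem; apply: (homo_sorted_in (P := predT) (e := fun l m : 'I_i => (l < m)%N)).
- by move=> l m _ _; apply: hd.
- by apply/allP.
have := iota_ltn_sorted 0 i; rewrite -val_enum_ord sorted_map.
by rewrite enumT.
Qed.

Lemma sdecr_perm h h' (s : 'S_i) : sdecr h -> sdecr h' ->
  (forall a, h (s a) = h' a) -> s = 1%g /\ h =1 h'.
Proof.
move=> hd h'd hs; have hh' : codom h = codom h'.
  apply: (sorted_eq (leT := gtn)); rewrite ?sdecr_sorted //.
  - by move=> x y z /= xy zx; apply: ltn_trans zx xy.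
  - by move=> x y /=; rewrite ltnNge => /andP[/negbTE xy /ltnW]; rewrite xy.
  have -> : codom h' = codom (h \o s) by apply: eq_codom => a; rewrite /= hs.
  rewrite /codom /image_mem (map_comp h s) perm_map // uniq_perm ?enum_uniq //.
    by rewrite map_inj_uniq ?enum_uniq //; apply: perm_inj.
  move=> a; rewrite mem_enum; apply/esym/mapP; exists ((s^-1)%g a).
    by rewrite mem_enum.
  by rewrite permKV.
have eqh : h =1 h'.
  move=> a; have := congr1 (nth 0%N ^~ (enum_rank a)) hh'.
  by rewrite /= !(nth_codom _ _ (enum_rank a)) enum_rankK.
split=> //; apply/permP => a; rewrite perm1.
have := hs a; rewrite -eqh => hsa.
case: (ltngtP (s a) a) => [/hd|/hd|/val_inj //]; by rewrite hsa ltnn.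
Qed.

Lemma mcoeff_alternant h h' : sdecr h -> sdecr h' ->
  (alternant h)@_[multinom h' a | a < i] = [forall a, h a == h' a]%:R.
Proof.
move=> hd h'd; rewrite alternantE raddf_sum /=.
have E (s : 'S_i) : ([multinom h (s a) | a < i] == [multinom h' a | a < i]) =
    (s == 1%g) && [forall a, h a == h' a].
  apply/eqP/andP => [/mnmP hs | [/eqP-> /forallP hh]]; last first.
    by apply/mnmP => a; rewrite !mnmE perm1 (eqP (hh a)).
  have [|->] := @sdecr_perm h h' s hd h'd; first by move=> a; have := hs a; rewrite !mnmE.
  by move=> hh; rewrite eqxx; split=> //; apply/forallP => a; apply/eqP.
rewrite (bigD1 (1%g : 'S_i)) //= big1 => [|s s1]; last first.
  by rewrite mcoeffZ mcoeffX E (negbTE s1) mulr0.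
by rewrite mcoeffZ mcoeffX E eqxx odd_perm1 expr0 mul1r addr0.
Qed.

Lemma delta_sdecr : sdecr delta.
Proof. move=> l m lm; rewrite /delta ltn_sub2l ?ltnS //.
by apply: leq_ltn_trans (ltn_ord m). Qed.

Lemma vandermonde_neq0 : alternant delta != 0.
Proof.
apply/eqP => /(congr1 (mcoeff [multinom delta a | a < i])).
rewrite mcoeff_alternant ?mcoeff0; try exact: delta_sdecr.
have -> : [forall a : 'I_i, delta a == delta a] by apply/forallP.
by move/eqP; rewrite oner_eq0.
Qed.

Lemma alternant_dvd h : exists s, s * alternant delta == alternant h.
Proof.
pose P : {poly {mpoly k[i]}} := \prod_(c <- [seq 'X_j | j <- index_enum 'I_i]) ('X - c%:P).
have Pm : P \is monic by apply: monic_prod_XsubC.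
have sP : size P = i.+1.
  by rewrite size_prod_XsubC size_map /index_enum -enumT size_enum_ord.
pose r n : {poly {mpoly k[i]}} := Pdiv.Ring.rmodp 'X^n P.
have rs n : (size (r n) <= i)%N.
  by rewrite -ltnS -sP Pdiv.Ring.ltn_rmodpN0 // monic_neq0.
have rX n a : (r n).['X_a] = 'X_a ^+ n.
  have := Pdiv.RingMonic.rdivp_eq Pm 'X^n => /(congr1 (horner^~ 'X_a)).
  rewrite hornerD hornerM hornerXn -/(r n) => ->.
  suff -> : P.['X_a] = 0 by rewrite mulr0 add0r.
  apply/eqP; rewrite -[_ == _]/(root P 'X_a) /P.
  rewrite root_prod_XsubC; apply/mapP; exists a => //.
  exact: mem_index_enum.
pose C : 'M_i := \matrix_(j < i, l < i) (r (h l))`_(delta j).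
exists (\det C); apply/eqP; rewrite [LHS]mulrC /alternant.
pose A : 'M[{mpoly k[i]}]_i := \matrix_(a < i, l < i) 'X_a ^+ delta l.
transitivity (\det (A *m C)); first by rewrite (det_mulmx A C).
congr (\det _).
apply/matrixP => a l; rewrite mxE [RHS]mxE -rX (horner_coef_wide _ (rs _)).
rewrite [RHS](reindex_inj rev_ord_inj) /=; apply: eq_bigr => j _.
by rewrite !mxE mulrC.
Qed.

Section Bounded.
Variable d : nat.

Definition shift (lam : part i d) (l : 'I_i) : nat := parts lam l + delta l.

(* The quotient of the two alternants; it is unique since [alternant delta] is
   not a zero divisor. *)
Definition schur (lam : part i d) : {mpoly k[i]} :=
  xchoose (alternant_dvd (shift lam)).

Lemma schurE lam : schur lam * alternant delta = alternant (shift lam).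
Proof. exact/eqP/(xchooseP (alternant_dvd (shift lam))). Qed.

Lemma parts_noninc m n (t : part m n) (l l' : 'I_m) :
  (l <= l')%N -> (parts t l' <= parts t l)%N.
Proof.
move=> ll'; have st := valP t.
have tE (a : 'I_m) : parts t a = nth 0%N [seq nat_of_ord j | j <- val t] a.
  by rewrite (nth_map ord0) ?size_tuple // -tnth_nth.
rewrite !tE; apply: (sorted_leq_nth _ _ 0%N st) => //.
- by move=> x y z /= xy zx; apply: leq_trans zx xy.
- by move=> x /=.
- by rewrite inE size_map size_tuple.
by rewrite inE size_map size_tuple.
Qed.

Lemma shift_sdecr lam : sdecr (shift lam).
Proof.
move=> l m lm; rewrite /shift -addnS leq_add ?delta_sdecr //.
by rewrite parts_noninc // ltnW.
Qed.

Lemma shift_eq lam mu : [forall a, shift lam a == shift mu a] = (lam == mu).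
Proof.
apply/forallP/eqP => [sh | -> //].
apply/val_inj/eq_from_tnth => a; apply/val_inj.
by have := eqP (sh a) => /addIn.
Qed.

(* The coefficient of [schur lam] in an element of the span below. *)
Definition schur_coef (lam : part i d) (f : {mpoly k[i]}) : k :=
  (f * alternant delta)@_[multinom shift lam l | l < i].

Lemma schur_coef_linear lam : linear (schur_coef lam : _ -> k^o).
Proof.
by move=> c f g; rewrite /schur_coef mulrDl -scalerAl mcoeffD mcoeffZ.
Qed.

Lemma schur_coefE (c : part i d -> k) mu :
  schur_coef mu (\sum_lam c lam *: schur lam) = c mu.
Proof.
rewrite /schur_coef mulr_suml raddf_sum (bigD1 mu) //= big1 => [|lam lm].
  rewrite -scalerAl schurE mcoeffZ mcoeff_alternant; try exact: shift_sdecr.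
  by rewrite shift_eq eqxx mulr1 addr0.
rewrite -scalerAl schurE mcoeffZ mcoeff_alternant; try exact: shift_sdecr.
by rewrite shift_eq (negbTE lm) mulr0.
Qed.

(* The span of the Schur polynomials; see [schur_spanP]. *)
Definition schur_span : {pred {mpoly k[i]}} :=
  [pred f | f == \sum_(lam : part i d) schur_coef lam f *: schur lam].

Lemma schur_spanP f :
  reflect (exists c : part i d -> k, f = \sum_lam c lam *: schur lam)
          (f \in schur_span).
Proof.
apply: (iffP eqP) => [-> | [c ->]]; first by eexists.
by apply: eq_bigr => lam _; rewrite schur_coefE.
Qed.

Lemma schur_span_submod : submod_closed schur_span.
Proof.
split=> [|c f g /schur_spanP[cf ->] /schur_spanP[cg ->]]; apply/schur_spanP.
  by exists (fun=> 0); rewrite big1 // => lam _; rewrite scale0r.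
exists (fun lam => c * cf lam + cg lam).
rewrite scaler_sumr -big_split; apply: eq_bigr => lam _.
by rewrite scalerDl scalerA.
Qed.

HB.instance Definition _ :=
  GRing.isSubmodClosed.Build k {mpoly k[i]} schur_span schur_span_submod.

(* The space spanned by the Schur polynomials of the partitions in an [i] by [d]
   box; by [epoly_in] it contains the products of elementary polynomials. *)
Record Lam := MkLam { Lam_poly :> {mpoly k[i]}; LamP : Lam_poly \in schur_span }.

HB.instance Definition _ := [isSub for Lam_poly].
HB.instance Definition _ := [Choice of Lam by <:].
HB.instance Definition _ := [SubChoice_isSubLmodule of Lam by <:].

Lemma schur_in lam : schur lam \in schur_span.
Proof.
apply/schur_spanP; exists (fun mu => (mu == lam)%:R).
rewrite (bigD1 lam) //= eqxx scale1r big1 ?addr0 // => mu /negbTE ->.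
by rewrite scale0r.
Qed.

Definition schurL lam : Lam := MkLam (schur_in lam).

Lemma Lam_vect : Vector.axiom #|{: part i d}| Lam.
Proof.
exists (fun f : Lam => \row_j schur_coef (enum_val j) (val f)).
  by move=> c f g; apply/rowP => j; rewrite !mxE schur_coef_linear.
exists (fun u : 'rV[k]_#|{: part i d}| => \sum_(lam : part i d) u 0 (enum_rank lam) *: schurL lam).
  move=> f; apply: val_inj; rewrite raddf_sum /= [RHS](eqP (LamP f)).
  by apply: eq_bigr => lam _; rewrite !mxE enum_rankK.
move=> u; apply/rowP => j; rewrite !mxE raddf_sum /=.
by rewrite schur_coefE enum_valK.
Qed.

HB.instance Definition _ := Lmodule_hasFinDim.Build k Lam Lam_vect.

Definition epoly (mu : part d i) : {mpoly k[i]} :=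
  \prod_(j < d) mesym i k (parts mu j).

End Bounded.
End Schur.

Lemma sdecr_gap (i : nat) (g : 'I_i -> nat) : sdecr g ->
  forall n (l m : 'I_i), m = (l + n)%N :> nat -> (g m + n <= g l)%N.
Proof.
move=> gd; elim=> [|n IH] l m ml.
  by move: ml; rewrite !addn0 => /val_inj ->.
have l1 : (l.+1 < i)%N by apply: leq_ltn_trans (ltn_ord m); rewrite ml; lia.
have := IH (Ordinal l1) m; have := gd l (Ordinal l1) (ltnSn _) => /= glt.
by rewrite ml addnS => /(_ erefl); lia.
Qed.

Lemma alternant_perm (k : fieldType) i h (s : 'S_i) :
  alternant k (h \o s) = (-1) ^+ s * alternant k h.
Proof.
rewrite /alternant mulrC -odd_permV -det_perm -det_mulmx -col_permE.
by congr (\det _); apply/matrixP => a l; rewrite !mxE.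
Qed.

Lemma alternant_span (k : fieldType) i d (h : 'I_i -> nat) :
  (forall a, h a < d + i)%N ->
  exists c : part i d -> k,
    alternant k h = \sum_lam c lam *: alternant k (shift lam).
Proof.
move=> hb; have [/injectiveP hinj|/injectivePn[a [b ab hab]]] := boolP (injectiveb h);
  last first.
  exists (fun=> 0); rewrite [RHS]big1 => [|lam _]; last by rewrite scale0r.
  rewrite /alternant -det_tr; apply: (determinant_alternate ab) => l.
  by rewrite !mxE hab.
have /tuple_permP[p pE] : perm_eq (sort geq (mktuple h)) (mktuple h).
  by rewrite perm_sort.
have srt : sorted gtn (sort geq (mktuple h)).
  rewrite gtn_sorted_uniq_geq sort_uniq map_inj_uniq ?enum_uniq //.
  by apply: sort_sorted => x y; exact: leq_total.
pose g := h \o p.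
have gE (a : 'I_i) : g a = nth 0%N (sort geq (mktuple h)) a.
  by rewrite pE -tnth_nth !tnth_mktuple.
have gd : sdecr g.
  move=> l m lm; rewrite !gE; apply: (sorted_ltn_nth _ 0%N srt) => //.
  - by move=> x y z /= xy zx; apply: ltn_trans zx xy.
  - by rewrite inE size_sort size_tuple.
  by rewrite inE size_sort size_tuple.
have gb a : (g a < d + i)%N by apply: hb.
have gap := sdecr_gap gd.
have ge_delta a : (delta a <= g a)%N.
  have i1 : (i.-1 < i)%N by have := ltn_ord a; lia.
  have := gap (i.-1 - a)%N a (Ordinal i1); rewrite /delta /=.
  by have := ltn_ord a; lia.
have lamb a : (g a - delta a < d.+1)%N.
  have i1 : (0 < i)%N by have := ltn_ord a; lia.
  have := gap a (Ordinal i1) a erefl; have := gb (Ordinal i1).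
  by rewrite /delta; have := ltn_ord a; lia.
pose t := [tuple Ordinal (lamb a) | a < i].
have ts : sorted geq [seq nat_of_ord j | j <- t].
  apply/(sortedP 0%N) => n; rewrite size_map size_tuple => ni.
  have ni' : (n < i)%N by apply: ltnW.
  rewrite !(nth_map ord0) ?size_tuple //.
  rewrite -(tnth_nth _ t (Ordinal ni')) -(tnth_nth _ t (Ordinal ni)).
  rewrite !tnth_mktuple /= /delta.
  by have := gd (Ordinal ni') (Ordinal ni) (ltnSn _); rewrite /=; lia.
pose mu : part i d := exist _ t ts.
have muE : shift mu =1 g.
  by move=> a; rewrite /shift /parts /= tnth_mktuple /= subnK.
exists (fun lam => (-1) ^+ p * (lam == mu)%:R).
rewrite (bigD1 mu) //= eqxx mulr1 [X in _ + X]big1 ?addr0; last first.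
  by move=> lam /negbTE ->; rewrite mulr0 scale0r.
have -> : alternant k (shift mu) = alternant k g.
  by congr (\det _); apply/matrixP => a l; rewrite !mxE muE.
by rewrite alternant_perm scaler_sign mulr_sign; case: (odd_perm p); rewrite ?opprK.
Qed.

Lemma sym_in_span (k : fieldType) i d (f : {mpoly k[i]}) :
  f \is symmetric -> (forall m, m \in msupp f -> forall a, m a <= d)%N ->
  f \in @schur_span k i d.
Proof.
move=> fsym fd.
have fE (s : 'S_i) :
    f = \sum_(m <- msupp f) f@_m *: 'X_[k, [multinom m (s a) | a < i]].
  rewrite -{1}(issymP _ fsym (s^-1)%g) {1}[f]mpolyE raddf_sum /=.
  apply: eq_bigr => m _; rewrite msymZ msymX invgK //.
have fA : f * alternant k (@delta i) =
    \sum_(m <- msupp f) f@_m *: alternant k (fun a => m a + delta a)%N.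
  rewrite alternantE mulr_sumr.
  under [RHS]eq_bigr => m _ do rewrite alternantE scaler_sumr.
  rewrite exchange_big /=; apply: eq_bigr => s _.
  rewrite {1}(fE s) mulr_suml; apply: eq_bigr => m _.
  rewrite -scalerAl -scalerAr -mpolyXD.
  by congr (_ *: (_ *: 'X_[_, _])); apply/mnmP => a; rewrite !mnmE.
have [c cE] : exists c : part i d -> k,
    f * alternant k (@delta i) = \sum_lam c lam *: alternant k (shift lam).
  rewrite fA; elim: (msupp f) fd => [|m ms IH] fd.
    exists (fun=> 0); rewrite big_nil [RHS]big1 // => lam _.
    by rewrite scale0r.
  have [c cE] : exists c : part i d -> k,
      alternant k (fun a => m a + delta a)%N =
      \sum_lam c lam *: alternant k (shift lam).
    apply: alternant_span => a; rewrite /delta.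
    by have := fd m (mem_head _ _) a; have := ltn_ord a; lia.
  have [|c' c'E] := IH; first by move=> m' m'ms; apply: fd; rewrite inE m'ms orbT.
  exists (fun lam => f@_m * c lam + c' lam).
  rewrite big_cons c'E cE scaler_sumr -big_split; apply: eq_bigr => lam _.
  by rewrite scalerDl scalerA.
apply/schur_spanP; exists c; apply: (mulIf (vandermonde_neq0 k i)).
rewrite cE mulr_suml; apply: eq_bigr => lam _.
by rewrite -scalerAl schurE.
Qed.

Lemma epoly_in (k : fieldType) i d (mu : part d i) :
  epoly k mu \in @schur_span k i d.
Proof.
apply: sym_in_span.
  by apply: rpred_prod => j _; apply: mesym_sym.
rewrite /epoly => m.
have : forall (r : seq 'I_d) m,
    m \in msupp (\prod_(j <- r) mesym i k (parts mu j)) ->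
    forall a, (m a <= size r)%N.
  elim=> [|j r IH] {}m.
    by rewrite big_nil msupp1 inE => /eqP -> a; rewrite mnm0E.
  rewrite big_cons => /msuppM_le /allpairsP[[m1 m2] /= [m1in m2in ->]] a.
  rewrite mnmDE (_ : (size r).+1 = 1 + size r)%N // leq_add ?IH //.
  move: m1in; rewrite msupp_mesymP => /existsP[A /andP[_ /eqP->]].
  by rewrite /mesym1 mnmE leq_b1.
by move=> H /H; rewrite /index_enum -enumT size_enum_ord.
Qed.

(** * The maps *)

Lemma free_codom (k : fieldType) (V : vectType k) (I : finType) (b : I -> V)
    (phi : I -> V -> k) :
  (forall j, scalar (phi j)) -> (forall j l, phi j (b l) = (l == j)%:R) ->
  free (codom b).
Proof.
move=> phil phib; apply/(freeP (X := codom_tuple b)) => c c0 l.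
pose j := enum_val l.
pose phiL : {linear V -> k^o} :=
  HB.pack (phi j) (GRing.isLinear.Build k V k^o _ (phi j) (phil j)).
have := congr1 phiL c0; rewrite linear_sum linear0 (bigD1 l) //.
have bE (m : 'I_#|I|) : (codom b)`_m = b (enum_val m).
  by rewrite -[m in LHS](enum_valK m) (nth_codom _ _ (enum_rank _)) ?enum_valK.
have phiZ (e : k) v : phiL (e *: v) = e * phi j v by rewrite linearZ.
rewrite phiZ bE phib eqxx mulr1 big1 => [|m ml]; first by move=> cl0; rewrite -[LHS]addr0; apply: cl0.
by rewrite phiZ bE phib (inj_eq enum_val_inj) (negbTE ml) mulr0.
Qed.

Lemma schurL_free (k : fieldType) i d : free (codom (@schurL k i d)).
Proof.
apply: (free_codom (phi := fun lam f => schur_coef lam (Lam_poly f))).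
  by move=> lam c f g; rewrite schur_coef_linear.
move=> lam mu; rewrite /schur_coef /= schurE mcoeff_alternant; try exact: shift_sdecr.
by rewrite shift_eq.
Qed.

Section TensorForms.
Variables (k : fieldType) (V : vectType k) (d : nat) (A : comAlgType k).
Variable c : 'I_d -> {linear V -> A}.

Definition tform (t : tpow V d) : A :=
  \sum_f tcoef t f *: \prod_(a < d) c a ((vbasis {:V})`_(f a)).

Lemma tform_linear : linear tform.
Proof.
move=> e t u; rewrite /tform scaler_sumr -big_split; apply: eq_bigr => f _ /=.
by rewrite tcoef_linear scalerDl scalerA.
Qed.

HB.instance Definition _ :=
  GRing.isLinear.Build k (tpow V d) A _ tform tform_linear.

Lemma tform_pure v : tform (pure v) = \prod_(a < d) c a (v a).
Proof.
rewrite /tform; pose F (a : 'I_d) j :=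
  coord (vbasis {:V}) j (v a) *: c a (vbasis {:V})`_j.
transitivity (\sum_(f : {ffun 'I_d -> 'I_(\dim {:V})}) \prod_(a < d) F a (f a)).
  apply: eq_bigr => f _; rewrite /tcoef ffunE scaler_prod //.
rewrite -(bigA_distr_bigA F); apply: eq_bigr => a _.
rewrite [v a in RHS](coord_vbasis (memvf (v a))) linear_sum.
by apply: eq_bigr => j _; rewrite linearZ.
Qed.

End TensorForms.

Lemma symprod_free (k : fieldType) (V : vectType k) (n d : nat)
    (y : 'I_n.+1 -> V) : free (codom y) ->
  free (codom (fun mu : part d n => symprod (fun a => y (tnth (val mu) a)))).
Proof.
move=> yf; pose l (v : V) : {mpoly k[n.+1]} :=
  \sum_j coord (codom_tuple y) (enum_rank j) v *: 'X_j.
have ll : linear l.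
  move=> e u v; rewrite /l scaler_sumr -big_split; apply: eq_bigr => j _ /=.
  by rewrite linearP scalerDl scalerA.
pose L : {linear V -> {mpoly k[n.+1]}} :=
  HB.pack l (GRing.isLinear.Build k V {mpoly k[n.+1]} _ l ll).
have ly j : l (y j) = 'X_j.
  have yE m : coord (codom_tuple y) m (y j) = (enum_rank j == m)%:R.
    have <- : (codom_tuple y)`_(enum_rank j) = y j.
      by rewrite /= (nth_codom _ _ (enum_rank j)) enum_rankK.
    by rewrite coord_free.
  rewrite /l (bigD1 j) //= yE eqxx scale1r big1 ?addr0 // => m mj.
  by rewrite yE (inj_eq enum_rank_inj) eq_sym (negbTE mj) scale0r.
pose Phi := tform (fun _ : 'I_d => L).
have Phi_act s t : Phi (tact s t) = Phi t.
  rewrite [t]tpow_sum /Phi !linear_sum; apply: eq_bigr => f _.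
  rewrite linearZ [LHS]linearZ [RHS]linearZ; congr (_ *: _).
  rewrite /= tact_pure !tform_pure.
  by rewrite [RHS](reindex_inj (@perm_inj _ (s^-1)%g)).
have Phi_rel t : t \in symrel V d -> Phi t = 0.
  move=> /memv_sumP[u uin ->]; rewrite /Phi linear_sum big1 // => s _.
  have /memv_imgP[t' _ ->] := uin s isT.
  rewrite add_lfunE opp_lfunE id_lfunE lfunE /=.
  by rewrite linearB /= -/Phi Phi_act subrr.
have Phi_sym v : Phi (vsval (symprod v)) = \prod_(a < d) l (v a).
  rewrite -(tform_pure (fun _ : 'I_d => L)) -/Phi; apply/eqP.
  rewrite -subr_eq0 -linearB /=; apply/eqP/Phi_rel.
  have qL := qproj_linear (symrel V d).
  rewrite -qproj_eq0 -scaleN1r addrC qL qprojK scaleN1r addrC.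
  by rewrite /symprod subrr.
pose mon (mu : part d n) : 'X_{1..n.+1} := (\sum_(a < d) U_(tnth (val mu) a))%MM.
have monE mu j : mon mu j = count_mem j (val mu).
  rewrite /mon mnm_sumE -sum1_count big_tuple [RHS]big_mkcond /=.
  by apply: eq_bigr => a _; rewrite mnm1E; case: (_ == j).
have mon_inj : injective mon.
  move=> lam mu lm; have perm : perm_eq (val lam) (val mu).
    by apply/allP => j _ /=; rewrite -!monE lm.
  have sE : [seq nat_of_ord j | j <- val lam] = [seq nat_of_ord j | j <- val mu].
    apply: (sorted_eq (leT := geq)) (valP lam) (valP mu) (perm_map _ perm).
    - by move=> p q r /= pq rp; apply: leq_trans rp pq.
    - by move=> p q /= /andP[qp pq]; apply/eqP; rewrite eqn_leq pq qp.
  by apply/val_inj/val_inj; apply: inj_map sE; apply: val_inj.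
apply: (free_codom (phi := fun mu q => (Phi (vsval q))@_(mon mu))).
  by move=> mu e q r; rewrite /Phi !linearP.
move=> mu lam; rewrite Phi_sym (eq_bigr (fun a => 'X_[U_(tnth (val lam) a)])).
  by rewrite mprodXE mcoeffX (inj_eq mon_inj).
by move=> a _; rewrite ly.
Qed.

Section Hermite.
Variables (k : fieldType) (U : vectType k) (x : 2.-tuple U) (i d : nat).

Local Notation x1 := (tnth x ord0).
Local Notation x2 := (tnth x ord_max).

(* The sum of the distinct permutations of [x1^(⊗j) ⊗ x2^(⊗(i - j))]; the word
   [w] marks the positions of [x1]. *)
Definition dpow_tens (j : nat) : tpow U i :=
  \sum_(w : {ffun 'I_i -> bool} | #|[set a | w a]| == j)
    pure (fun a => if w a then x1 else x2).

Lemma dpow_sym j : dpow_tens j \in symtens U i.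
Proof.
apply/symtensP => s; rewrite /dpow_tens linear_sum.
pose h (w : {ffun 'I_i -> bool}) : {ffun 'I_i -> bool} :=
  [ffun a => w (s a)].
have h_inj : injective h.
  move=> w w' /ffunP hw; apply/ffunP => a.
  by have := hw ((s^-1)%g a); rewrite !ffunE permKV.
rewrite [LHS](reindex_inj h_inj) /=; apply: eq_big => [w | w _].
  rewrite (_ : [set a | h w a] = s @^-1: [set a | w a]).
    by rewrite card_preimset //; apply: perm_inj.
  by apply/setP => a; rewrite !inE ffunE.
by rewrite tact_pure; apply: eq_pure => a; rewrite ffunE permKV.
Qed.

Definition dpow (j : nat) : divpow U i := vsproj (symtens U i) (dpow_tens j).

Lemma dpowE j : vsval (dpow j) = dpow_tens j.
Proof. by rewrite vsprojK ?dpow_sym. Qed.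

(* The element [x^p] of [Sym^N U], i.e. the monomial [x1^p x2^(N - p)]. *)
Definition spow (N p : nat) : sympow U N :=
  symprod (fun a : 'I_N => if (a < p)%N then x1 else x2).

Definition epolyL (mu : part d i) : Lam k i d := MkLam (epoly_in k mu).

Definition dmon (mu : part d i) : sympow (divpow U i) d :=
  symprod (fun a => dpow (parts mu a)).

Definition epsilon : 'Hom(sympow (divpow U i) d, Lam k i d) :=
  lext dmon epolyL.

Definition swedge (lam : part i d) : extpow (sympow U (d + i - 1)) i :=
  wedge (fun l => spow (d + i - 1) (shift lam l)).

Definition sigma : 'Hom(Lam k i d, extpow (sympow U (d + i - 1)) i) :=
  lext (@schurL k i d) swedge.

(* See [epsilonE] and [sigmaE] for the values of the two maps. *)
Definition psi : 'Hom(sympow (divpow U i) d, extpow (sympow U (d + i - 1)) i) :=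
  (sigma \o epsilon)%VF.

Lemma sigmaE lam : sigma (schurL k lam) = swedge lam.
Proof. exact: lextE (schurL_free k i d). Qed.

Lemma dpow_free : basis_of {:U} x -> free (codom (fun j : 'I_i.+1 => dpow j)).
Proof.
move=> /basis_free xf.
pose c (j : 'I_i.+1) (a : 'I_i) : {linear U -> k^o} :=
  coord x (if (a < j)%N then ord0 else ord_max).
apply: (free_codom (phi := fun j t => tform (c j) (vsval t))).
  by move=> j e t u; rewrite !linearP.
have xE (b b' : bool) :
    coord x (if b then ord0 else ord_max) (if b' then x1 else x2) = (b == b')%:R.
  by case: b; case: b'; rewrite (tnth_nth 0) coord_free.
move=> j l; rewrite dpowE /dpow_tens linear_sum /=.
pose w0 : {ffun 'I_i -> bool} := [ffun a : 'I_i => (a < j)%N].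
have card0 : #|[set a | w0 a]| = j.
  have widen_inj (ji : (j <= i)%N) : injective (widen_ord ji).
    by move=> a b /(congr1 val) ab; apply: val_inj.
  have ji : (j <= i)%N by rewrite -ltnS.
  rewrite -[RHS](card_ord j) -(card_imset _ (widen_inj ji)).
  apply: eq_card => a; rewrite !inE ffunE; apply/idP/imsetP => [aj | [b _ ->]].
    by exists (Ordinal aj) => //; apply: val_inj.
  exact: (ltn_ord b).
have tE (w : {ffun 'I_i -> bool}) :
    tform (c j) (pure (fun a => if w a then x1 else x2)) = (w == w0)%:R :> k.
  rewrite tform_pure; case: eqP => [-> | /eqP ww0].
    rewrite big1 // => a _; rewrite ffunE.
    by apply: etrans (xE _ _) _; rewrite eqxx.
  have [a wa] : exists a, w a != w0 a.
    apply/existsP; rewrite -negb_forall; apply: contra ww0 => /forallP wE.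
    by apply/eqP/ffunP => a; apply/eqP.
  have c0 : c j a (if w a then x1 else x2) = 0.
    apply: etrans (xE _ _) _; move: wa.
    by rewrite ffunE eq_sym => /negbTE ->.
  by rewrite (bigD1 a) // c0; apply: mul0r.
rewrite (eq_bigr _ (fun w _ => tE w)) -natr_sum big_mkcond (bigD1 w0) //= card0 eqxx.
rewrite big1 ?addn0 => [|w /negbTE ->]; last by case: ifP.
by rewrite -val_eqE /= eq_sym; case: eqP.
Qed.

Lemma epsilonE mu : basis_of {:U} x -> epsilon (dmon mu) = epolyL mu.
Proof.
move=> xb; apply: lextE.
exact: (@symprod_free k (divpow U i) i d (fun j : 'I_i.+1 => dpow j) (dpow_free xb)).
Qed.

End Hermite.

(* Main.v *)
Require Import Defs.
From HB Require Import structures.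
From mathcomp Require Import all_boot all_order all_fingroup all_algebra.
From mathcomp Require Import mpoly ring.

Set Implicit Arguments.
Unset Strict Implicit.
Unset Printing Implicit Defensive.

Import GRing.Theory.

Local Open Scope ring_scope.

(** Dehomogenize [x1 |-> z_a, x2 |-> 1] in the [a]-th tensor factor. This sends
    [D^i U] to polynomials in [z_1, ..., z_i], with [x^(j) |-> e_j], hence
    [Sym^d (D^i U)] to symmetric polynomials (this is [epsilon]), and, after
    antisymmetrization, it embeds [/\^i (Sym^N U)] into the alternating polynomials,
    [x^h_1 /\ ... /\ x^h_i] going to the alternant with exponents [h]. In these
    terms [psi] is the multiplication by the Vandermonde determinant [V].
    An endomorphism [g] of [U] acts on the two sides as the first order operators
    [X + d W] and [X + N W], where [X] is a derivation and [W] is the sum of the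
    linear forms of [g x2]. If [g] has trace zero, then
    [X (z_b - z_a) = - (w_a + w_b) (z_b - z_a)], so that [X V = - (i - 1) W V],
    and the two actions agree for [N = d + i - 1]. *)

(** * Traces, and derivations acting on tensor powers *)

Lemma lftrace_basis (k : fieldType) (V : vectType k) (n : nat) (f : n.-tuple V)
    (g : 'End(V)) :
  basis_of {:V} f -> lftrace g = \sum_(j < n) coord f j (g f`_j).
Proof.
move=> fb; rewrite /lftrace; set e := vbasis {:V}; have eb := vbasisP {:V}.
transitivity (\sum_(i < \dim {:V}) coord e i (g e`_i)).
  by apply: eq_bigr => i _; rewrite !mxE /= passmx.vecof_delta.
(* Expanding [g e_i] in the basis [f] and expanding [f_j] in the basis [e] lead to this same double
   sum. *)
transitivity (\sum_(i < \dim {:V}) \sum_j coord f j (g e`_i) * coord e i f`_j).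
  apply: eq_bigr => i _; rewrite {1}(coord_basis fb (memvf (g e`_i))) linear_sum.
  by apply: eq_bigr => j _; rewrite linearZ.
rewrite exchange_big; apply: eq_bigr => j _ /=.
rewrite [in RHS](coord_basis eb (memvf f`_j)) !linear_sum.
by apply: eq_bigr => i _; rewrite !linearZ /= mulrC.
Qed.

Lemma eq_pure_linear (k : fieldType) (V : vectType k) (d : nat) (W : lmodType k)
    (F H : tpow V d -> W) :
  linear F -> linear H -> (forall v, F (pure v) = H (pure v)) -> F =1 H.
Proof.
move=> Fl Hl FH t.
pose FL : {linear tpow V d -> W} := HB.pack F (GRing.isLinear.Build _ _ _ _ F Fl).
pose HL : {linear tpow V d -> W} := HB.pack H (GRing.isLinear.Build _ _ _ _ H Hl).
rewrite -[F t]/(FL t) -[H t]/(HL t) [t]tpow_sum !linear_sum.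
by apply: eq_bigr => f _; rewrite !linearZ /=; congr (_ *: _); apply: FH.
Qed.

Lemma deriv_prod (A : comPzRingType) (X : A -> A) (I : finType) (F : I -> A) :
  (forall p q, X (p * q) = X p * q + p * X q) ->
  X (\prod_a F a) = \sum_a X (F a) * \prod_(b | b != a) F b.
Proof.
move=> XM.
have X1 : X 1 = 0.
  by have := XM 1 1; rewrite !mulr1 mul1r -[LHS]addr0 => /addrI.
suff E : forall r : seq I, uniq r -> X (\prod_(a <- r) F a) =
    \sum_(a <- r) X (F a) * \prod_(b <- r | b != a) F b.
  by apply: E; apply: index_enum_uniq.
elim=> [|a r IH] /=; first by rewrite !big_nil X1.
case/andP=> ar ur; rewrite !big_cons XM IH // eqxx /=; congr (_ * _ + _).
  rewrite big_seq [RHS]big_seq_cond; apply: eq_bigl => b.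
  by rewrite andb_idr // => br; apply: contraNneq ar => <-.
rewrite mulr_sumr big_seq [RHS]big_seq; apply: eq_bigr => b br.
rewrite big_cons ifT; first by rewrite mulrCA.
by apply: contraNneq ar => ->.
Qed.

(** On a pure tensor, [tder g] replaces one factor at a time. By hypothesis this differentiates the
    corresponding factor of the product, up to an extra multiple [w a] of the whole product; the
    Leibniz rule collects the first terms into [X]. *)
Lemma tform_tder (k : fieldType) (V : vectType k) (d : nat) (A : comAlgType k)
    (c : 'I_d -> {linear V -> A}) (X : {linear A -> A}) (w : 'I_d -> A)
    (g : {linear V -> V}) :
  (forall p q, X (p * q) = X p * q + p * X q) ->
  (forall a v, c a (g v) = X (c a v) + w a * c a v) ->
  forall t, tform c (tder g t) = X (tform c t) + (\sum_a w a) * tform c t.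
Proof.
move=> XM cg; apply: eq_pure_linear => [e t u | e t u | v].
- by rewrite !linearP.
- by rewrite !linearP /= scalerDr mulrDr -scalerAr addrACA.
rewrite tder_pure linear_sum /= tform_pure deriv_prod // mulr_suml -big_split.
apply: eq_bigr => a _ /=; rewrite tform_pure (bigD1 a) //= /upd eqxx cg.
rewrite [\prod_(i < d) c i (v i)](bigD1 a) //= mulrDl mulrA.
by congr (_ * _ + _ * _); apply: eq_bigr => b /negbTE ->.
Qed.

(** The actions are iterated in [symder (divder g)] and [extder (symder g)], and the lemmas on forms
    expect a linear structure on the inner map; hence this instance and the one for [symder g]. *)
Lemma divder_linear (k : fieldType) (V : vectType k) (d : nat)
    (g : {linear V -> V}) : linear (@divder k V d g).
Proof.
move=> c t u; apply: val_inj; rewrite -!/(vsval _) linearP /= !divderE.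
by rewrite !linearP.
Qed.

HB.instance Definition _ (k : fieldType) (V : vectType k) (d : nat)
    (g : {linear V -> V}) :=
  GRing.isLinear.Build k (divpow V d) (divpow V d) _ (divder g)
    (divder_linear g).

Lemma symder_linear (k : fieldType) (V : vectType k) (d : nat)
    (g : {linear V -> V}) : linear (@symder k V d g).
Proof.
move=> c t u; rewrite /symder /qmap -(qproj_linear (symrel V d)).
by rewrite -(tder_linear g).
Qed.

HB.instance Definition _ (k : fieldType) (V : vectType k) (d : nat)
    (g : {linear V -> V}) :=
  GRing.isLinear.Build k (sympow V d) (sympow V d) _ (symder g)
    (symder_linear g).

(** * Spanning families of symmetric and exterior powers *)

Lemma pure_sum (k : fieldType) (V : vectType k) (d : nat) (J : finType)
    (y : J -> V) (F : 'I_d -> J -> k) :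
  pure (fun a => \sum_j F a j *: y j) =
  \sum_(w : {ffun 'I_d -> J}) (\prod_a F a (w a)) *: pure (fun a => y (w a)).
Proof.
apply/ffunP => f; rewrite ffunE sum_ffunE.
pose G a j := F a j * coord (vbasis {:V}) (f a) (y j).
rewrite (eq_bigr (fun a => \sum_j G a j)) => [|a _]; last first.
  by rewrite linear_sum; apply: eq_bigr => j _; rewrite linearZ.
by rewrite bigA_distr_bigA; apply: eq_bigr => w _; rewrite !ffunE big_split.
Qed.

(** Multilinear expansion reduces a spanning claim in any quotient of the tensor power to words in a
    spanning family [y]. It serves both [sympow] and [extpow]. *)
Lemma quot_span (k : fieldType) (V : vectType k) (d : nat) (J : finType)
    (y : J -> V) (R : {vspace tpow V d}) (W : {vspace quot R}) :
  <<codom y>>%VS = fullv ->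
  (forall w : {ffun 'I_d -> J}, qproj R (pure (fun a => y (w a))) \in W) ->
  forall q, q \in W.
Proof.
move=> yV yW q; rewrite -[q]qprojK.
pose Q : {linear tpow V d -> quot R} :=
  HB.pack (qproj R) (GRing.isLinear.Build _ _ _ _ _ (qproj_linear R)).
rewrite -[qproj R]/(Q : _ -> _) [vsval q]tpow_sum linear_sum.
apply: rpred_sum => f _.
rewrite linearZ rpredZ //.
pose F a j := coord (codom_tuple y) (enum_rank j) (wtens f a).
have -> : pure (wtens f) = pure (fun a => \sum_j F a j *: y j).
  apply: eq_pure => a.
  have va : wtens f a \in <<codom_tuple y>>%VS by rewrite yV memvf.
  rewrite [LHS](coord_span va) (reindex (@enum_rank J)) /=; last first.
    by apply: onW_bij; apply: enum_rank_bij.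
  apply: eq_bigr => j _; rewrite /F; congr (_ *: _).
  by rewrite (nth_codom _ _ (enum_rank j)) enum_rankK.
rewrite pure_sum linear_sum; apply: rpred_sum => w _; rewrite linearZ rpredZ //.
exact: yW.
Qed.

Lemma symprod_perm (k : fieldType) (V : vectType k) (d : nat) (s : 'S_d)
    (v : 'I_d -> V) :
  symprod (fun a => v (s a)) = symprod v.
Proof.
apply/eqP; rewrite -subr_eq0 /symprod -scaleN1r addrC -qproj_linear qproj_eq0.
rewrite scaleN1r addrC; apply: (subvP (sumv_sup (s^-1)%g isT (subvv _))).
apply/memv_imgP; exists (pure v); first exact: memvf.
rewrite add_lfunE opp_lfunE id_lfunE lfunE /= tact_pure; congr (_ - _).
by apply: eq_pure => a; rewrite invgK.
Qed.

Lemma wedge_eq0 (k : fieldType) (V : vectType k) (d : nat) (v : 'I_d -> V) a b :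
  a != b -> v a = v b -> wedge v = 0.
Proof.
move=> ab vab; apply/eqP; rewrite /wedge qproj_eq0.
exact: (altrelP _).1 (subvv _) v a b ab vab.
Qed.

(** The sum of a pure tensor and its image under [tperm a b] is fixed by [tperm a b], hence lies in
    [altrel]. *)
Lemma wedge_tperm (k : fieldType) (V : vectType k) (d : nat) (v : 'I_d -> V) a b :
  a != b -> wedge (fun c => v (tperm a b c)) = - wedge v.
Proof.
move=> ab; apply/eqP; rewrite -addr_eq0 /wedge -[X in _ + X]scale1r addrC.
rewrite -qproj_linear qproj_eq0 scale1r.
apply: (subvP (sumv_sup (a, b) ab (subvv _))); apply/fixedSpaceP.
rewrite lfunE linearD /= !tact_pure addrC tpermV.
by congr (_ + _); apply: eq_pure => c; rewrite tpermK.
Qed.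

Lemma wedge_perm (k : fieldType) (V : vectType k) (d : nat) (s : 'S_d)
    (v : 'I_d -> V) :
  wedge (fun a => v (s a)) = (-1) ^+ s *: wedge v.
Proof.
have [ts -> dts] := prod_tpermP s; elim: ts dts v => [_ v|[a b] ts IH] /=.
  rewrite big_nil odd_perm1 scale1r /wedge; congr (qproj _ _).
  by apply: eq_pure => a; rewrite perm1.
case/andP=> ab dts v; rewrite big_cons odd_permM odd_tperm ab signr_addb /=.
rewrite expr1 mulN1r scaleNr -IH // -(wedge_tperm _ ab).
by congr (qproj _ _); apply: eq_pure => c; rewrite permM.
Qed.

Lemma part_sort (d n : nat) (w : 'I_d -> 'I_n.+1) :
  exists mu : part d n, exists s : 'S_d, forall a, w a = tnth (val mu) (s a).
Proof.
pose e : rel 'I_n.+1 := relpre (@nat_of_ord n.+1) geq.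
have ts : sorted geq [seq nat_of_ord j | j <- sort_tuple e (mktuple w)].
  by rewrite sorted_map; apply: sort_sorted => p q; apply: leq_total.
pose mu : part d n := exist _ (sort_tuple e (mktuple w)) ts; exists mu.
have /tuple_permP[s sE] : perm_eq (mktuple w) (sort_tuple e (mktuple w)).
  by rewrite perm_sym /= perm_sort.
exists s => a; rewrite -[LHS](tnth_mktuple w) (tnth_nth (w a)) sE.
by rewrite -tnth_nth tnth_mktuple.
Qed.

Lemma symprod_span (k : fieldType) (V : vectType k) (n d : nat)
    (y : 'I_n.+1 -> V) : <<codom y>>%VS = fullv ->
  <<codom (fun mu : part d n => symprod (fun a => y (tnth (val mu) a)))>>%VS =
  fullv.
Proof.
move=> yV; apply/eqP; rewrite eqEsubv subvf; apply/subvP => q _.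
apply: (quot_span yV) q => w; have [mu [s ws]] := part_sort w.
rewrite -[qproj _ _]/(symprod (fun a => y (w a))).
rewrite (_ : symprod _ = symprod (fun a => y (tnth (val mu) a))).
  by rewrite memv_span // codom_f.
rewrite -[RHS](symprod_perm s); congr (qproj _ _).
by apply: eq_pure => a; rewrite ws.
Qed.

Lemma spow_span (k : fieldType) (U : vectType k) (x : 2.-tuple U) (N : nat) :
  basis_of {:U} x -> <<codom (fun p : 'I_N.+1 => spow x N p)>>%VS = fullv.
Proof.
(* Index [1] stands for [x1], so that a decreasing word lists the [x1] first, as [spow] does. *)
move=> xb; pose y (j : 'I_2) := if j == ord_max then tnth x ord0 else tnth x ord_max.
have yU : <<codom y>>%VS = fullv.
  apply/eqP; rewrite eqEsubv subvf -(span_basis xb) /=; apply/span_subvP => u.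
  case/tnthP=> j ->; apply: memv_span; apply/codomP.
  have [-> | ->] : j = ord0 \/ j = ord_max.
    by case: j => -[|[|//]] jlt; [left | right]; apply: val_inj.
  - by exists ord_max; rewrite /y eqxx.
  by exists ord0.
apply/eqP; rewrite eqEsubv subvf -(symprod_span N yU) /=; apply/span_subvP => q.
case/codomP=> mu ->; pose s := [seq nat_of_ord j | j <- val mu].
have szs : size s = N by rewrite size_map size_tuple.
(* The exponent of [x1] is the position of the first [0] in the decreasing word, and [N] if there is
   none. *)
have pN : (find (pred1 0%N) s < N.+1)%N by rewrite ltnS -[X in (_ <= X)%N]szs find_size.
have sE (a : 'I_N) : nth 0%N s a = parts mu a.
  by rewrite /parts /s (nth_map ord0) ?size_tuple // -tnth_nth.
rewrite (_ : symprod _ = spow x N (Ordinal pN)).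
  by rewrite memv_span // (codom_f (fun p : 'I_N.+1 => spow x N p)).
congr (qproj _ _); apply: eq_pure => a; rewrite /y /=.
suff -> : (tnth (val mu) a == ord_max) = (a < find (pred1 0%N) s)%N by [].
have [ap|pa] := ltnP a _.
  have := before_find 0%N ap; rewrite sE /= /parts -val_eqE /=.
  by have := ltn_ord (tnth (val mu) a); case: (nat_of_ord _) => [|[|]].
have pN' := leq_ltn_trans pa (ltn_ord a).
have := nth_find 0%N (a := pred1 0%N) (s := s).
rewrite has_find szs => /(_ pN'); rewrite -[find _ _]/(val (Ordinal pN')) sE /=.
move=> /eqP p0; have := parts_noninc mu (l := Ordinal pN') pa.
by rewrite p0 leqn0 /parts -val_eqE /= => /eqP ->.
Qed.

Lemma shift_sort (i d : nat) (h : 'I_i -> nat) : injective h ->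
  (forall a, h a < d + i)%N ->
  exists lam : part i d, exists s : 'S_i, forall a, h a = shift lam (s a).
Proof.
(* The monomial [h] has coefficient 1 in [alternant h], hence it occurs in the
   alternant of some [shift lam]. *)
move=> h_inj hb; have [c cE] := alternant_span rat hb.
pose m := [multinom h a | a < i].
have m1 : (alternant rat h)@_m = 1.
  rewrite alternantE raddf_sum (bigD1 (1%g : 'S_i)) //= big1 => [|s s1].
    rewrite mcoeffZ mcoeffX odd_perm1 expr0 mul1r addr0.
    by case: eqP => // -[]; apply/mnmP => a; rewrite !mnmE perm1.
  rewrite mcoeffZ mcoeffX; case: eqP => [/mnmP hs|_]; last by rewrite mulr0.
  case/eqP: s1; apply/permP => a; rewrite perm1; apply: h_inj.
  by have := hs a; rewrite !mnmE.
have [lam lam0] : exists lam : part i d, (alternant rat (shift lam))@_m != 0.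
  apply/existsP; apply: contraT; rewrite negb_exists => /forallP c0.
  move/eqP: m1; rewrite cE raddf_sum big1 //= => lam _.
  by rewrite mcoeffZ (eqP (negbNE (c0 lam))) mulr0.
have [s sE] : exists s : 'S_i, [multinom shift lam (s a) | a < i] == m.
  apply/existsP; apply: contraNT lam0; rewrite negb_exists => /forallP s0.
  rewrite alternantE raddf_sum big1 //= => s _.
  by rewrite mcoeffZ mcoeffX (negbTE (s0 s)) mulr0.
by exists lam, s => a; move/eqP/mnmP: sE => /(_ a); rewrite !mnmE.
Qed.

Lemma swedge_span (k : fieldType) (U : vectType k) (x : 2.-tuple U) (i d : nat) :
  basis_of {:U} x -> (0 < i)%N -> <<codom (@swedge k U x i d)>>%VS = fullv.
Proof.
move=> xb i0; apply/eqP; rewrite eqEsubv subvf; apply/subvP => q _.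
apply: (quot_span (spow_span (d + i - 1) xb)) q => w.
rewrite -[qproj _ _]/(wedge (fun a => spow x (d + i - 1) (w a))).
have [/injectiveP w_inj|/injectivePn[a [b ab wab]]] := boolP (injectiveb w);
  last by rewrite (wedge_eq0 ab) ?mem0v // wab.
have [||lam [s ws]] := @shift_sort i d (fun a => w a).
- by move=> a b /val_inj /w_inj.
- move=> a; apply: leq_trans (ltn_ord (w a)) _.
  by rewrite subn1 prednK // addn_gt0 i0 orbT.
rewrite (_ : wedge _ = (-1) ^+ s *: swedge x lam).
  by rewrite rpredZ // memv_span // codom_f.
rewrite -(wedge_perm s (fun l => spow x (d + i - 1) (shift lam l))).
by congr (qproj _ _); apply: eq_pure => a; rewrite ws.
Qed.

(** * Polynomial-valued forms on symmetric and exterior powers *)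

(** [vsval (qproj R t)] is a representative of the class of [t] in the complement of [R]; it differs
    from [t] by an element of [R], which [F] kills. *)
Lemma qproj_desc (k : fieldType) (T : vectType k) (R : {vspace T})
    (A : lmodType k) (F : T -> A) (t : T) :
  linear F -> (forall u, u \in R -> F u = 0) -> F (vsval (qproj R t)) = F t.
Proof.
move=> Fl F0.
pose FL : {linear T -> A} := HB.pack F (GRing.isLinear.Build _ _ _ _ F Fl).
apply/eqP; rewrite -subr_eq0 -![F _]/(FL _) -linearB; apply/eqP/F0.
by rewrite -qproj_eq0 -scaleN1r addrC qproj_linear qprojK scaleN1r addNr.
Qed.

Section Forms.
Variables (k : fieldType) (V : vectType k) (d : nat) (A : comAlgType k).

Lemma tform_act (c : 'I_d -> {linear V -> A}) (s : 'S_d) t :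
  tform c (tact s t) = tform (fun a => c (s a)) t.
Proof.
move: t; apply: eq_pure_linear => [e t u | e t u | v]; rewrite ?linearP //.
rewrite tact_pure !tform_pure (reindex_inj (@perm_inj _ s)).
by apply: eq_bigr => a _; rewrite permK.
Qed.

Definition symform (c : {linear V -> A}) (q : sympow V d) : A :=
  tform (fun=> c) (vsval q).

Lemma symform_linear c : linear (symform c).
Proof. by move=> e q r; rewrite /symform -[RHS]linearP. Qed.

HB.instance Definition _ c :=
  GRing.isLinear.Build k (sympow V d) A _ (symform c) (symform_linear c).

Lemma symform_qproj c t : symform c (qproj _ t) = tform (fun=> c) t.
Proof.
apply: qproj_desc => [e u v|u]; first exact: linearP.
move=> /memv_sumP[v vin ->]; rewrite linear_sum big1 // => s _.
have /memv_imgP[w _ ->] := vin s isT.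
by rewrite add_lfunE opp_lfunE id_lfunE lfunE linearB /= tform_act subrr.
Qed.

Lemma symform_prod c v : symform c (symprod v) = \prod_a c (v a).
Proof. by rewrite symform_qproj tform_pure. Qed.

(** The form is evaluated on the representative in the complement. The signs make the underlying
    form on tensors vanish on [altrel], so this choice does not matter; see [extform_qproj]. *)
Definition extform (c : 'I_d -> {linear V -> A}) (q : extpow V d) : A :=
  \sum_(s : 'S_d) (-1) ^+ s *: tform (fun a => c (s a)) (vsval q).

Lemma extform_linear c : linear (extform c).
Proof.
move=> e q r; rewrite /extform scaler_sumr -big_split; apply: eq_bigr => s _ /=.
by rewrite scalerA mulrC -scalerA -scalerDr -[X in _ = _ *: X]linearP.
Qed.

HB.instance Definition _ c :=
  GRing.isLinear.Build k (extpow V d) A _ (extform c) (extform_linear c).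

Lemma extform_qproj c t : extform c (qproj _ t) =
  \sum_(s : 'S_d) (-1) ^+ s *: tform (fun a => c (s a)) t.
Proof.
pose F t : A := \sum_(s : 'S_d) (-1) ^+ s *: tform (fun a => c (s a)) t.
have Fl : linear F.
  move=> e u w; rewrite /F scaler_sumr -big_split; apply: eq_bigr => s _ /=.
  by rewrite scalerA mulrC -scalerA -scalerDr linearP.
pose FL : {linear tpow V d -> A} := HB.pack F (GRing.isLinear.Build _ _ _ _ F Fl).
apply: (qproj_desc _ Fl) => u /memv_sumP[v vin ->].
rewrite -[F _]/(FL _) linear_sum big1 // => -[a b] /= ab.
have /fixedSpaceP := vin (a, b) ab; rewrite lfunE /= => vab.
(* Left multiplication by [tperm a b] matches even with odd permutations, and matched terms cancel
   on a tensor fixed by [tperm a b]. Nothing is divided by 2, so characteristic 2 is covered. *)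
rewrite /F (bigID (fun s : 'S_d => odd_perm s)) /= addrC.
rewrite (reindex_inj (mulgI (tperm a b))) /= -[RHS](subrr (\sum_(s : 'S_d | s)
  tform (fun a => c (s a)) (v (a, b)))) -sumrN; congr (_ + _).
  apply: eq_big => [s|s]; rewrite odd_permM odd_tperm ab /= ?negbK // => ->.
  rewrite scale1r -{2}vab tform_act /tform; apply: eq_bigr => f _.
  by congr (_ *: _); apply: eq_bigr => e _; rewrite permM.
by apply: eq_bigr => s ->; rewrite expr1 scaleN1r.
Qed.

Lemma extform_wedge c v :
  extform c (wedge v) = \det (\matrix_(l, a) c a (v l)).
Proof.
rewrite extform_qproj; apply: eq_bigr => s _.
rewrite tform_pure scaler_sign mulr_sign.
by rewrite [in RHS](eq_bigr (fun a => c (s a) (v a))) // => a _; rewrite mxE.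
Qed.

Variables (X : {linear A -> A}) (g : {linear V -> V}).
Hypothesis XM : forall p q, X (p * q) = X p * q + p * X q.

Lemma symform_der (c : {linear V -> A}) (w : A) :
  (forall v, c (g v) = X (c v) + w * c v) ->
  forall q, symform c (symder g q) = X (symform c q) + (w *+ d) * symform c q.
Proof.
move=> cg q; rewrite /symder /qmap symform_qproj (tform_tder XM (w := fun=> w)) //.
by rewrite sumr_const card_ord.
Qed.

(** Permuting the forms does not change the total multiplier [\sum_a w a], which therefore factors
    out of the signed sum. *)
Lemma extform_der (c : 'I_d -> {linear V -> A}) (w : 'I_d -> A) :
  (forall a v, c a (g v) = X (c a v) + w a * c a v) ->
  forall q, extform c (extder g q) = X (extform c q) + (\sum_a w a) * extform c q.
Proof.
move=> cg q; rewrite /extder /qmap extform_qproj linear_sum mulr_sumr -big_split.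
apply: eq_bigr => s _ /=.
rewrite (tform_tder XM (w := fun a => w (s a))); last by move=> a v; apply: cg.
rewrite [\sum_a w a](reindex_inj (@perm_inj _ s)).
by rewrite scalerDr linearZ scalerAr.
Qed.

End Forms.

(** * Dehomogenization and the vector field of an endomorphism *)

Section Polynomials.
Variables (k : fieldType) (U : vectType k) (x : 2.-tuple U) (i : nat).
Hypothesis xb : basis_of {:U} x.

Local Notation x1 := (tnth x ord0).
Local Notation x2 := (tnth x ord_max).
Local Notation P := {mpoly k[i]}.

Definition lform (a : 'I_i) (u : U) : P :=
  coord x ord0 u *: 'X_a + coord x ord_max u *: 1.

Lemma lform_linear a : linear (lform a).
Proof.
move=> e u v; rewrite /lform scalerDr !scalerA.
rewrite [coord x ord0 _]linearP [coord x ord_max _]linearP /= !scalerDl.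
by rewrite addrACA.
Qed.

HB.instance Definition _ a :=
  GRing.isLinear.Build k U P _ (lform a) (lform_linear a).

Lemma lform_x1 a : lform a x1 = 'X_a.
Proof.
by rewrite /lform (tnth_nth 0) !coord_free ?(basis_free xb) // scale1r scale0r addr0.
Qed.

Lemma lform_x2 a : lform a x2 = 1.
Proof.
by rewrite /lform (tnth_nth 0) !coord_free ?(basis_free xb) // scale1r scale0r add0r.
Qed.

Lemma coord_x12 u : u = coord x ord0 u *: x1 + coord x ord_max u *: x2.
Proof.
rewrite {1}(coord_basis xb (memvf u)) big_ord_recl big_ord1 !(tnth_nth 0).
by congr (_ + coord x _ _ *: x`_ _); apply: val_inj.
Qed.

Definition vfield (C : 'I_i -> P) (p : P) : P := \sum_a C a * p^`M(a).

Lemma vfield_linear C : linear (vfield C).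
Proof.
move=> e p q; rewrite /vfield scaler_sumr -big_split; apply: eq_bigr => a _ /=.
by rewrite mderivD mderivZ mulrDr scalerAr.
Qed.

HB.instance Definition _ C :=
  GRing.isLinear.Build k P P _ (vfield C) (vfield_linear C).

Lemma vfieldM C p q : vfield C (p * q) = vfield C p * q + p * vfield C q.
Proof.
rewrite /vfield mulr_suml mulr_sumr -big_split; apply: eq_bigr => a _ /=.
by rewrite mderivM mulrDr !mulrA [C a * p]mulrC.
Qed.

Lemma vfieldX C a : vfield C 'X_a = C a.
Proof.
rewrite /vfield (bigD1 a) //= big1 => [|b ba]; rewrite mderivX mnm1E.
  rewrite eqxx scale1r addr0 (_ : _ - _ = 0)%MM ?mpolyX0 ?mulr1 //.
  by apply/mnmP => b; rewrite !mnmE subnn.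
by rewrite eq_sym (negbTE ba) scale0r mulr0.
Qed.

Section Action.
Variable g : {linear U -> U}.

(* On [Sym^N U], seen as the polynomials in [z_a] of degree at most [N], [g] acts
   as [gvfield] plus [N] times the multiplication by [gmult a]. *)
Definition gmult (a : 'I_i) : P := lform a (g x2).

Definition gvfield : P -> P :=
  vfield (fun a => lform a (g x1) - 'X_a * lform a (g x2)).

HB.instance Definition _ := GRing.Linear.on gvfield.

(** By linearity only [x1] and [x2] matter. At [x2] the form is [1], which a derivation kills, so
    the multiplier has to be [gmult a]; at [x1] the form is ['X_a], which then forces the
    coefficients of [gvfield]. *)
Lemma lform_der a u :
  lform a (g u) = gvfield (lform a u) + gmult a * lform a u.
Proof.
have gx1 : lform a (g x1) = gvfield (lform a x1) + gmult a * lform a x1.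
  by rewrite lform_x1 /gvfield vfieldX /gmult [_ * 'X_a]mulrC subrK.
have X1 : gvfield 1 = 0.
  rewrite /gvfield /vfield big1 // => b _.
  by rewrite -mpolyC1 mderivC mulr0.
have gx2 : lform a (g x2) = gvfield (lform a x2) + gmult a * lform a x2.
  by rewrite lform_x2 X1 add0r mulr1.
have lin2 (V W : lmodType k) (F : V -> W) p q y z :
    linear F -> F (p *: y + q *: z) = p *: F y + q *: F z.
  move=> Fl; have F0 : F 0 = 0.
    by have := Fl 1 0 0; rewrite !scale1r addr0 -[LHS]addr0 => /addrI.
  by rewrite Fl -[q *: z]addr0 Fl F0 addr0.
have ll := lform_linear a; have gl : linear g by apply: linearP.
have Xl : linear gvfield by apply: linearP.
rewrite {1 2 3}[u]coord_x12 (lin2 _ _ _ _ _ _ _ gl) !(lin2 _ _ _ _ _ _ _ ll).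
rewrite (lin2 _ _ _ _ _ _ _ Xl) gx1 gx2.
move: (lform a x1) (lform a x2) => l1 l2.
move: (gvfield l1) (gvfield l2) => q1 q2.
by rewrite !scalerDr mulrDr -!scalerAr addrACA.
Qed.

Definition divform (t : divpow U i) : P := tform lform (vsval t).

Lemma divform_linear : linear divform.
Proof. by move=> e t u; rewrite /divform !linearP. Qed.

HB.instance Definition _ :=
  GRing.isLinear.Build k (divpow U i) P _ divform divform_linear.

Lemma divform_der t :
  divform (divder g t) = gvfield (divform t) + (\sum_a gmult a) * divform t.
Proof.
by rewrite /divform divderE (tform_tder (X := gvfield) (vfieldM _) lform_der).
Qed.

Lemma divform_dpow j : divform (dpow x i j) = mesym i k j.
Proof.
rewrite /divform dpowE /dpow_tens linear_sum /mesym.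
(* Words marking the positions of [x1] become the subsets that index the monomials of [mesym]. *)
rewrite (reindex (fun h : {set 'I_i} => [ffun a => a \in h])) /=.
  apply: eq_big => [h|h _].
    by congr (#|pred_of_set _| == _); apply/setP => a; rewrite inE ffunE.
  rewrite tform_pure [RHS]big_mkcond; apply: eq_bigr => a _ /=.
  by rewrite ffunE; case: ifP => _; rewrite ?lform_x1 ?lform_x2.
exists (fun w : {ffun 'I_i -> bool} => [set a | w a]) => [h _|w _].
  by apply/setP => a; rewrite inE ffunE.
by apply/ffunP => a; rewrite ffunE inE.
Qed.

(** The bound matters: for [p > N] every factor of [spow x N p] is [x1], and the value is
    ['X_a ^+ N]. *)
Lemma symform_spow N p a : (p <= N)%N -> symform (lform a) (spow x N p) = 'X_a ^+ p.
Proof.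
move=> pN; rewrite symform_prod (bigID (fun b : 'I_N => (b < p)%N)) /=.
rewrite (eq_bigr (fun=> 'X_a)) => [|b ->]; last exact: lform_x1.
rewrite prodr_const [X in _ * X]big1 ?mulr1; last first.
  by move=> b /negbTE ->; apply: lform_x2.
congr (_ ^+ _).
have card_lt := card_ord p.
rewrite -{2}card_lt -(card_image (f := widen_ord pN)); last first.
  by move=> b c /(congr1 val) bc; apply: val_inj.
apply: eq_card => b; apply/idP/imageP => [bp|[c _ ->]].
  by exists (Ordinal (bp : (b < p)%N)) => //; apply: val_inj.
exact: (ltn_ord c).
Qed.

End Action.

End Polynomials.

(** * Counting partitions, independence of the [epoly], and dimension bounds *)

Lemma card_part (m n : nat) : #|{: part m n}| = 'C(m + n, m).
Proof.
rewrite card_sig -card_sorted_tuples.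
(* [card_sorted_tuples] counts weakly increasing tuples, so the tuples are reversed. *)
have rev_inj : injective (fun t : m.-tuple 'I_n.+1 => [tuple of rev t]).
  by move=> t u /(congr1 val) /(can_inj revK) /val_inj.
rewrite -(card_preimset _ rev_inj); apply: eq_card => t.
by rewrite !inE /= map_rev rev_sorted.
Qed.

(** The total number of parts is [m], which recovers the number of zero parts. These are invisible
    in a product of elementary polynomials because [e_0 = 1]. *)
Lemma part_count_inj (m n : nat) (lam mu : part m n) :
  (forall l : 'I_n, count_mem (lift ord0 l) (val lam) =
                    count_mem (lift ord0 l) (val mu)) -> lam = mu.
Proof.
have szE (t : part m n) : (count_mem ord0 (val t) +
    \sum_(l < n) count_mem (lift ord0 l) (val t) = m)%N.
  rewrite -(big_ord_recl n (fun j => count_mem j (val t))).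
  transitivity (\sum_(j < n.+1) \sum_(p <- val t) (p == j))%N.
    by apply: eq_bigr => j _; rewrite -sum1_count big_mkcond.
  rewrite exchange_big -[RHS](size_tuple (val t)) -sum1_size.
  apply: eq_bigr => p _ /=; rewrite (bigD1 p) //= eqxx big1 // => j.
  by rewrite eq_sym => /negbTE ->.
move=> lm; have perm : perm_eq (val lam) (val mu).
  apply/allP => j _ /=; case: (unliftP ord0 j) => [l ->|->]; first by rewrite lm.
  have := etrans (szE lam) (esym (szE mu)).
  by rewrite (eq_bigr _ (fun l _ => lm l)) => /addIn ->.
have sE : [seq nat_of_ord j | j <- val lam] = [seq nat_of_ord j | j <- val mu].
  apply: (sorted_eq (leT := geq)) (valP lam) (valP mu) (perm_map _ perm).
  - by move=> p q r /= pq rp; apply: leq_trans rp pq.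
  - by move=> p q /= /andP[qp pq]; apply/eqP; rewrite eqn_leq pq qp.
by apply/val_inj/val_inj; apply: inj_map sE; apply: val_inj.
Qed.

(** Distinct [mu] give distinct monomials in [e_1, ..., e_i], which are algebraically independent by
    [msym_fundamental_un0]. *)
Lemma epoly_free (k : fieldType) (i d : nat) (c : part d i -> k) :
  \sum_mu c mu *: epoly k mu = 0 -> forall mu, c mu = 0.
Proof.
pose S := [tuple mesym i k l.+1 | l < i].
pose u (j : 'I_i.+1) : 'X_{1..i} := if unlift ord0 j is Some l then U_(l)%MM else 0%MM.
have uE j : 'X_[u j] \mPo S = mesym i k j.
  rewrite /u; case: unliftP => [l ->|->].
    by rewrite comp_mpolyXU -tnth_nth tnth_mktuple.
  by rewrite mpolyX0 rmorph1 mesym0E.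
pose mon (mu : part d i) : 'X_{1..i} := (\sum_(a < d) u (tnth (val mu) a))%MM.
have monE mu : 'X_[mon mu] \mPo S = epoly k mu.
  by rewrite -mprodXE rmorph_prod; apply: eq_bigr => a _; apply: uE.
have mon_count mu l : mon mu l = count_mem (lift ord0 l) (val mu).
  rewrite /mon mnm_sumE -sum1_count big_tuple [RHS]big_mkcond /=.
  apply: eq_bigr => a _; rewrite /u; case: unliftP => [m ->|->].
    by rewrite mnm1E (inj_eq lift_inj); case: (m == l).
  by rewrite mnm0E (negbTE (neq_lift _ _)).
have mon_inj : injective mon.
  by move=> lam mu lm; apply: part_count_inj => l; rewrite -!mon_count lm.
move=> c0 mu; have /msym_fundamental_un0 t0 :
    (\sum_mu c mu *: 'X_[mon mu]) \mPo S = 0.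
  by rewrite linear_sum -[RHS]c0; apply: eq_bigr => lam _; rewrite linearZ /= monE.
have := congr1 (mcoeff (mon mu)) t0; rewrite mcoeff0 raddf_sum (bigD1 mu) //=.
rewrite big1 => [|lam lm]; rewrite mcoeffZ mcoeffX.
  by rewrite eqxx mulr1 addr0.
by rewrite (inj_eq mon_inj) (negbTE lm) mulr0.
Qed.

Definition coord_form (k : fieldType) (V : vectType k) (n : nat) (x : n.-tuple V)
  (j : 'I_n) : {linear V -> k^o} := coord x j.

Lemma tpow_coord (k : fieldType) (V : vectType k) (n d : nat) (x : n.-tuple V)
    (t : tpow V d) : basis_of {:V} x ->
  t = \sum_(w : {ffun 'I_d -> 'I_n})
        (tform (fun a => coord_form x (w a)) t : k^o) *: pure (fun a => x`_(w a)).
Proof.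
move=> xb; pose H (t : tpow V d) : tpow V d := \sum_(w : {ffun 'I_d -> 'I_n})
  (tform (fun a => coord_form x (w a)) t : k^o) *: pure (fun a => x`_(w a)).
apply: (@eq_pure_linear k V d (tpow V d) id H) t => [//|e t u|v]; rewrite /H.
  rewrite scaler_sumr -big_split; apply: eq_bigr => w _ /=.
  by rewrite linearP [LHS]scalerDl scalerA.
rewrite [LHS](eq_pure (w := fun a => \sum_j coord x j (v a) *: x`_j)).
  by rewrite pure_sum; apply: eq_bigr => w _; rewrite tform_pure.
by move=> a; apply: coord_basis (memvf _).
Qed.

(** The coordinates of a symmetric tensor agree on words that are permutations of each other, so
    those on decreasing words determine it. *)
Lemma divpow_dim (k : fieldType) (V : vectType k) (n d : nat)
    (x : n.+1.-tuple V) : basis_of {:V} x ->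
  (\dim {:divpow V d} <= #|{: part d n}|)%N.
Proof.
move=> xb; pose c (mu : part d n) (t : divpow V d) : k^o :=
  tform (fun a => coord_form x (tnth (val mu) a)) (vsval t).
pose F (t : divpow V d) : 'rV[k]_#|{: part d n}| := \row_j c (enum_val j) t.
have Fl : linear F.
  by move=> e t u; apply/rowP => j; rewrite !mxE /c !linearP.
pose FL : {linear divpow V d -> 'rV[k]_#|{: part d n}|} :=
  HB.pack F (GRing.isLinear.Build _ _ _ _ F Fl).
have F_inj : lker (linfun FL) == 0%VS.
  apply/lker0P => t u; rewrite !lfunE => tu; apply: val_inj.
  rewrite -!/(vsval _) [LHS](tpow_coord _ xb) [RHS](tpow_coord _ xb).
  apply: eq_bigr => w _; congr (_ *: _); have [mu [s ws]] := part_sort w.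
  have wE (q : divpow V d) :
      tform (fun a => coord_form x (w a)) (vsval q) = c mu q :> k^o.
    rewrite /c -{2}(symtensP _ (subvsP q) s) tform_act /tform.
    by apply: eq_bigr => f _; congr (_ *: _); apply: eq_bigr => a _; rewrite ws.
  have /rowP/(_ (enum_rank mu)) := tu.
  by rewrite !mxE enum_rankK !wE.
rewrite -(limg_dim_eq (f := linfun FL)); last by rewrite (eqP F_inj) capv0.
by rewrite (leq_trans (dimvS (subvf _))) // dimvf /dim /= mul1n.
Qed.

Lemma full_span (k : fieldType) (V : vectType k) (I : finType) (b : I -> V) :
  free (codom b) -> (\dim {:V} <= #|I|)%N -> <<codom b>>%VS = fullv.
Proof.
move=> bf dimV; apply/eqP; rewrite eqEdim subvf /=.
by move: bf; rewrite /free => /eqP ->; rewrite size_codom.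
Qed.

Lemma span_sum (k : fieldType) (V : vectType k) (I : finType) (b : I -> V) v :
  <<codom b>>%VS = fullv -> exists c : I -> k, v = \sum_j c j *: b j.
Proof.
move=> bV; have : v \in <<codom_tuple b>>%VS by rewrite bV memvf.
move=> /coord_span ->; exists (fun j => coord (codom_tuple b) (enum_rank j) v).
rewrite (reindex (@enum_rank I)) /=; last by apply: onW_bij; apply: enum_rank_bij.
by apply: eq_bigr => j _; rewrite (nth_codom _ _ (enum_rank j)) enum_rankK.
Qed.

(** * Action on the Vandermonde determinant, bijectivity and equivariance *)

Lemma deriv_prod_log (A : comPzRingType) (X : A -> A) (I : Type) (r : seq I)
    (Q : pred I) (u F : I -> A) :
  (forall p q, X (p * q) = X p * q + p * X q) ->
  (forall a, Q a -> X (F a) = u a * F a) ->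
  X (\prod_(a <- r | Q a) F a) = (\sum_(a <- r | Q a) u a) * \prod_(a <- r | Q a) F a.
Proof.
move=> XM Xu; apply: (big_ind2 (fun v f => X f = v * f)) => //.
  have X1 : X 1 = 0 by have := XM 1 1; rewrite !mulr1 mul1r -[LHS]addr0 => /addrI.
  by rewrite X1 mul0r.
move=> v f w h Xf Xh; rewrite XM Xf Xh mulrDl -mulrA; congr (_ + _).
exact: mulrCA.
Qed.

Section Equivariance.
Variables (k : fieldType) (U : vectType k) (x : 2.-tuple U) (i d : nat).
Hypothesis xb : basis_of {:U} x.

Local Notation P := {mpoly k[i]}.
Local Notation V := (alternant k (@delta i)).

Lemma gvfield_vandermonde (g : 'End(U)) : lftrace g = 0 ->
  gvfield x g V = - ((\sum_a gmult x g a) *+ i.-1) * V.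
Proof.
move=> tr0; set X := gvfield x g; set w := gmult x g.
have XM p q : X (p * q) = X p * q + p * X q by apply: vfieldM.
(* [X] sends each ['X_a] to one quadratic polynomial evaluated at ['X_a], so the difference is
   divisible by ['X_b - 'X_a]. Trace zero makes the two diagonal entries of [g] opposite, which
   identifies the quotient. *)
have XB a b : X ('X_b - 'X_a) = - (w a + w b) * ('X_b - 'X_a).
  rewrite /X /gvfield linearB /= !vfieldX /w /gmult /lform.
  move: tr0; rewrite (lftrace_basis g xb) big_ord_recl big_ord1 !(tnth_nth 0) /=.
  rewrite (_ : lift ord0 ord0 = ord_max :> 'I_2); last exact: val_inj.
  move: (coord _ _ _) (coord _ _ _) (coord _ _ _) (coord _ _ _) => p q r t.
  move=> /eqP; rewrite addr_eq0 => /eqP ->.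
  by rewrite -!mul_mpolyC rmorphN; ring.
(* The exponents [delta] decrease while those of [det_Vandermonde] increase; reversing the columns
   costs only a sign. *)
pose s : 'S_i := perm (@rev_ord_inj i).
have VE : V = (-1) ^+ s * \prod_(a < i) \prod_(b < i | (a < b)%N) ('X_b - 'X_a).
  have -> : V = alternant k ((fun l : 'I_i => l : nat) \o s).
    by congr (\det _); apply/matrixP => a l; rewrite !mxE /= permE.
  rewrite alternant_perm; congr (_ * _).
  have := det_Vandermonde (\row_(a < i) ('X_a : P)).
  rewrite -det_tr /alternant => E; apply: etrans (etrans _ E) _.
    by congr (\det _); apply/matrixP => a l; rewrite !mxE.
  by apply: eq_bigr => a _; apply: eq_bigr => b _; rewrite !mxE.
(* Each [w a] occurs once for every [b] different from [a], that is, [i - 1] times. *)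
have sumE : \sum_(a < i) \sum_(b < i | (a < b)%N) (w a + w b) =
    (\sum_a w a) *+ i.-1.
  under eq_bigr => a _ do rewrite big_split.
  rewrite big_split /= [X in _ + X](exchange_big_dep xpredT) //=.
  rewrite -big_split -sumrMnl; apply: eq_bigr => a _ /=.
  transitivity (\sum_(b < i | b != a) w a); last by rewrite sumr_const cardC1 card_ord.
  rewrite [RHS](bigID (fun b : 'I_i => (a < b)%N)) /=.
  by congr (_ + _); apply: eq_bigl => b; rewrite -val_eqE /=; case: ltngtP.
set p := \prod_(a < i) _ in VE.
have pE : X p = - ((\sum_a w a) *+ i.-1) * p.
  pose v (a : 'I_i) := \sum_(b < i | (a < b)%N) - (w a + w b).
  rewrite /p (deriv_prod_log _ (u := v) XM).
    rewrite -sumE -sumrN; congr (_ * _).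
    by apply: eq_bigr => a _; rewrite /v sumrN.
  move=> a _; apply: (deriv_prod_log _ (u := fun b => - (w a + w b)) XM) => b _.
  exact: XB.
rewrite VE mulr_sign; case: ifP => _ //.
by rewrite mulrN -pE /X linearN.
Qed.

Lemma swedge_form lam :
  extform (fun a => symform (lform x a)) (swedge x lam) =
  alternant k (@shift i d lam).
Proof.
rewrite extform_wedge /alternant -det_tr; congr (\det _).
apply/matrixP => a l; rewrite !mxE /= symform_spow //.
rewrite /shift /parts /delta; have := ltn_ord (tnth (val lam) l).
rewrite ltnS => le; have := ltn_ord l => li.
by rewrite -addnBA ?leq_add // ?(leq_trans _ li) // leq_sub2l.
Qed.

(** On a Schur polynomial this is its definition [schurE] as a quotient of alternants; the rest is
    linearity. *)
Lemma sigma_form (f : Lam k i d) :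
  extform (fun a => symform (lform x a)) (sigma x i d f) = Lam_poly f * V.
Proof.
have fE : f = \sum_lam schur_coef lam (Lam_poly f) *: schurL k lam.
  by apply: val_inj; rewrite raddf_sum /= [LHS](eqP (LamP f)).
have LE := congr1 val fE; rewrite raddf_sum /= in LE.
rewrite {1}fE linear_sum linear_sum {2}LE mulr_suml; apply: eq_bigr => lam _.
rewrite linearZ /= sigmaE linearZ /= swedge_form -schurE.
by rewrite scalerAl.
Qed.

Lemma dmon_span : <<codom (@dmon k U x i d)>>%VS = fullv.
Proof.
apply: (@symprod_span k (divpow U i) i d (fun j : 'I_i.+1 => dpow x i j)).
apply: full_span (dpow_free i xb) _.
(* Since [U] has a basis of two vectors, the bound counts partitions with [i] parts of size at most
   1: there are [i + 1], as many as the [dpow]. *)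
by rewrite (leq_trans (divpow_dim _ xb)) // card_part card_ord addn1 binSn.
Qed.

(** It is enough to compare on the spanning family [dmon], where [divform_dpow] turns each factor
    into an elementary polynomial. *)
Lemma epsilon_form q :
  symform (@divform _ _ x i) q = Lam_poly (epsilon x i d q).
Proof.
have [c ->] := span_sum q dmon_span; rewrite -[Lam_poly _]/(val _) !linear_sum /=.
apply: eq_bigr => mu _; rewrite !linearZ /=; congr (_ *: _).
rewrite (epsilonE _ xb) symform_prod; apply: eq_bigr => a _.
exact: divform_dpow.
Qed.

Lemma psi_form q :
  extform (fun a => symform (lform x a)) (psi x i d q) =
  symform (@divform _ _ x i) q * V.
Proof. by rewrite /psi comp_lfunE sigma_form epsilon_form. Qed.

Lemma symform_divform_eq0 q : symform (@divform _ _ x i) q = 0 -> q = 0 :> sympow _ d.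
Proof.
rewrite epsilon_form; have [c ->] := span_sum q dmon_span => c0.
rewrite big1 // => mu _; rewrite (epoly_free (c := c)) ?scale0r //.
rewrite -[RHS]c0 -[Lam_poly _]/(val _) !linear_sum; apply: eq_bigr => lam _.
by rewrite linearZ /= epsilonE.
Qed.

(** Polynomials over a field form a domain and the Vandermonde determinant is nonzero. This gives
    both the injectivity of [psi] and the faithfulness of the form on its image. *)
Lemma psi_form_eq0 q :
  extform (fun a => symform (lform x a)) (psi x i d q) = 0 -> q = 0.
Proof.
rewrite psi_form => /eqP.
rewrite mulf_eq0 (negbTE (vandermonde_neq0 k i)) orbF => /eqP.
exact: symform_divform_eq0.
Qed.

Lemma psi_ker : lker (psi x i d) == 0%VS.
Proof.
rewrite -subv0; apply/subvP => q; rewrite memv_ker memv0 => /eqP q0.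
by apply/eqP/psi_form_eq0; rewrite q0 linear0.
Qed.

End Equivariance.

Theorem lemma3p3 (k : fieldType) (U : vectType k) (x : 2.-tuple U)
    (i d : nat) (dimU : \dim {:U} = 2%N) (xb : basis_of {:U} x)
    (i_gt0 : (0 < i)%N) :
  bijective (psi x i d) /\
  (forall g : 'End(U), lftrace g = 0 ->
   forall t : sympow (divpow U i) d,
     psi x i d (symder (divder g) t) = extder (symder g) (psi x i d t)).
Proof.
have ker0 := psi_ker i d xb.
have img : limg (psi x i d) = fullv.
  apply/eqP; rewrite eqEdim subvf limg_dim_eq; last by rewrite (eqP ker0) capv0.
  (* The target is spanned by the [swedge], the [dmon] are free in the source, and the two families
     have equal size by the symmetry of binomial coefficients. *)
  rewrite -(swedge_span d xb i_gt0) (leq_trans (dim_span _)) //.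
  rewrite size_codom card_part addnC -(bin_sub (leq_addl d i)) addnK -card_part.
  rewrite -(dmon_span i d xb) -(size_codom (@dmon k U x i d)).
  have dmon_free := @symprod_free k (divpow U i) i d (fun j : 'I_i.+1 => dpow x i j)
    (dpow_free i xb).
  by move: dmon_free; rewrite /free => /eqP ->.
have psi_bij : bijective (psi x i d).
  exists (psi x i d)^-1%VF; first exact: lker0_lfunK.
  by move=> q; rewrite limg_lfunVK // img memvf.
split=> // g tr0 t.
pose Theta := extform (fun a : 'I_i => symform (d := d + i - 1) (lform x a)).
(* As [psi] is onto and [Theta] vanishes on [psi q] only for [q = 0], equality in the exterior power
   can be tested on polynomials. *)
have Theta_inj q r : Theta q = Theta r -> q = r.
  have [psi' _ psiK] := psi_bij.
  move=> /eqP; rewrite /Theta -subr_eq0 -linearB -[q - r]psiK => /eqP q0.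
  apply/eqP; rewrite -subr_eq0 -[q - r]psiK.
  by rewrite (psi_form_eq0 xb q0) linear0.
apply: Theta_inj; rewrite /Theta psi_form //.
have XM (p q : {mpoly k[i]}) : gvfield x g (p * q) =
    gvfield x g p * q + p * gvfield x g q by apply: vfieldM.
rewrite (symform_der (X := gvfield x g) XM (divform_der xb g)).
rewrite (extform_der (X := gvfield x g) (w := fun a => gmult x g a *+ (d + i - 1)) XM).
  (* With [F] the polynomial of [t], the term [- (i - 1) W F V] from [X V] cancels against
     [(d + i - 1) W F V] and leaves [d W F V]. Here [0 < i] turns the truncated [d + i - 1] into
     [d + (i - 1)]. *)
  rewrite psi_form // /= XM gvfield_vandermonde // sumrMnl -addnBA // subn1 mulrnDr.
  ring.
by move=> a v; apply: (symform_der (X := gvfield x g) XM); apply: lform_der xb _ _.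
Qed.
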